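(* For every integer $n\ge 1$, \begin{align*} &73760 \sum_{\substack{a,b \in \mathbb{N}\\ a+b=n}} \sigma_7(a) L_{6;2}(b) - \frac{194432}{3} \sum_{\substack{a,b \in \mathbb{N}\\ a+b=n}} \sigma_5(a) L_{8;4}(b) + 60336 \sum_{\substack{a,b \in \mathbb{N}\\ a+b=n}} \sigma_3(a) L_{10;6}(b)\\ &\quad = -\frac{461}{3} L_{6;2}(n) - \frac{3472}{27} L_{8;4}(n) - \frac{1257}{5} L_{10;6}(n) + \frac{94477}{735} L_{14;10}(n) + \frac{864}{245} L_{14;8}(n) + \frac{144}{175} L_{14;6}(n). \end{align*}
   Context: For a positive integer $k$, let $F_k(x_1,\ldots,x_{2k}) = \sum_{j=1}^k \left(x_{2j-1}^2 + x_{2j-1}x_{2j} + x_{2j}^2\right)$. $\mathbb{N}=\{1,2,3,\ldots\}$; $\sigma_r(n)=\sum_{d\mid n}d^r$. For $n\ge1$ define \begin{align*} L_{6;2}(n) &= \sum_{F_{2}(x_1,\ldots,x_{4})=n} \left(9 x_1^4 - 9 n x_1^2 + n^2\right),\\ L_{8;4}(n) &= \sum_{F_{4}(x_1,\ldots,x_{8})=n} \left(45 x_1^4 - 30 n x_1^2 + 2 n^2\right),\\ L_{10;6}(n) &= \sum_{F_6(x_1,\ldots,x_{12})=n} \left(42 x_1^4 - 21n x_1^2 + n^2\right),\\ L_{14;10}(n) &= \sum_{F_{10}(x_1,\ldots,x_{20})=n} \left(99x_1^4 - 33 n x_1^2 + n^2\right),\\ L_{14;8}(n) &= \sum_{F_{8}(x_1,\ldots,x_{16})=n}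 \left(594 x_1^6 - 495 n x_1^4 + 90n^2x_1^2 - 2n^3\right),\\ L_{14;6}(n) &= \sum_{F_{6}(x_1,\ldots,x_{12})=n} \left(8019 x_1^8 - 12474 n x_1^6 + 5670n^2x_1^4 - 756 n^3 x_1^2+ 14n^4\right), \end{align*} each sum being over all integer vectors $(x_1,\ldots,x_{2k})\in\mathbb{Z}^{2k}$ with $F_k(x_1,\ldots,x_{2k})=n$ for the indicated $k$. *)

(* Defs.v *)
From mathcomp Require Export all_boot all_order all_algebra.
From mathcomp Require Export mathcomp_extra boolp classical_sets functions.
From mathcomp Require Export cardinality fsbigop.
From mathcomp Require Import ring lra zify.

Set Implicit Arguments.
Unset Strict Implicit.
Unset Printing Implicit Defensive.

Import Order.TTheory GRing.Theory Num.Theory.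
Local Open Scope classical_set_scope.
Local Open Scope ring_scope.

(* Vectors are indexed from 0: x`_i is the coordinate usually written x_(i+1). *)
Definition F (k : nat) (x : (2 * k).-tuple int) : int :=
  \sum_(j < k) (x`_(2 * j) ^+ 2 + x`_(2 * j) * x`_(2 * j).+1
                + x`_(2 * j).+1 ^+ 2).

Definition sigma (r n : nat) : nat := (\sum_(d <- divisors n) d ^ r)%N.

Definition reps (k n : nat) : set ((2 * k).-tuple int) :=
  [set x | F x = n%:Z].

Lemma form_bound (a b : int) (n : nat) :
  a ^+ 2 + a * b + b ^+ 2 <= n%:Z -> - (2 * n)%:Z <= a <= (2 * n)%:Z.
Proof.
move=> h.
have h3 : 3 * a ^+ 2 <= 4 * n%:Z.
  have -> : 3 * a ^+ 2 = 4 * (a ^+ 2 + a * b + b ^+ 2) - (a + 2 * b) ^+ 2.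
    by ring.
  by have := sqr_ge0 (a + 2 * b); lia.
have : `|a| <= a ^+ 2 by rewrite -real_normK ?num_real //; nia.
by move=> h1; apply/andP; split; lia.
Qed.

(* A sum over a classical set is 0 by convention when it has infinitely many
   nonzero terms; this never happens below because the form is definite. *)
Lemma finite_reps (k n : nat) : finite_set (@reps k n).
Proof.
pose g (i : 'I_(4 * n).+1) : int := (i : nat)%:Z - (2 * n)%:Z.
pose G (t : (2 * k).-tuple 'I_(4 * n).+1) := map_tuple g t.
apply: (@sub_finite_set _ _ (G @` setT)); last exact/finite_image/finite_finset.
move=> x; rewrite /reps /= => Fx.
have q_ge0 (a b : int) : 0 <= a ^+ 2 + a * b + b ^+ 2.
  have : 0 <= a ^+ 2 + b ^+ 2 + (a + b) ^+ 2 by rewrite !addr_ge0 ?sqr_ge0.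
  have -> : a ^+ 2 + b ^+ 2 + (a + b) ^+ 2 = 2 * (a ^+ 2 + a * b + b ^+ 2).
    by ring.
  by rewrite pmulr_rge0.
have bnd (i : 'I_(2 * k)) : - (2 * n)%:Z <= tnth x i <= (2 * n)%:Z.
  have ltik : (i %/ 2 < k)%N by rewrite ltn_divLR // [(k * 2)%N]mulnC ltn_ord.
  have : x`_(2 * (i %/ 2)) ^+ 2 + x`_(2 * (i %/ 2)) * x`_(2 * (i %/ 2)).+1
         + x`_(2 * (i %/ 2)).+1 ^+ 2 <= n%:Z.
    rewrite -Fx /F (bigD1 (Ordinal ltik)) //= lerDl.
    by apply: sumr_ge0 => j _; apply: q_ge0.
  rewrite (tnth_nth 0) => h.
  have := divn_eq i 2; rewrite modn2 [(_ * 2)%N]mulnC => Ei.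
  rewrite [X in x`_X]Ei; case: (odd i); last by rewrite addn0; exact: form_bound h.
  rewrite addn1.
  by apply: (@form_bound _ x`_(2 * (i %/ 2))); apply: le_trans h; lia.
exists [tuple inord `|(tnth x i + (2 * n)%:Z)%R|%N | i < 2 * k] => //.
apply: eq_from_tnth => i; rewrite tnth_map tnth_mktuple /g.
have := bnd i; move: (tnth x i) => z /andP[z_ge z_le].
by rewrite inordK; lia.
Qed.

Definition L6_2 (n : nat) : int :=
  \sum_(x \in @reps 2 n)
    (9 * x`_0 ^+ 4 - 9 * n%:Z * x`_0 ^+ 2 + n%:Z ^+ 2).

Definition L8_4 (n : nat) : int :=
  \sum_(x \in @reps 4 n)
    (45 * x`_0 ^+ 4 - 30 * n%:Z * x`_0 ^+ 2 + 2 * n%:Z ^+ 2).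

Definition L10_6 (n : nat) : int :=
  \sum_(x \in @reps 6 n)
    (42 * x`_0 ^+ 4 - 21 * n%:Z * x`_0 ^+ 2 + n%:Z ^+ 2).

Definition L14_10 (n : nat) : int :=
  \sum_(x \in @reps 10 n)
    (99 * x`_0 ^+ 4 - 33 * n%:Z * x`_0 ^+ 2 + n%:Z ^+ 2).

Definition L14_8 (n : nat) : int :=
  \sum_(x \in @reps 8 n)
    (594 * x`_0 ^+ 6 - 495 * n%:Z * x`_0 ^+ 4 + 90 * n%:Z ^+ 2 * x`_0 ^+ 2
     - 2 * n%:Z ^+ 3).

(* The explicit %:R keeps literals above 5000 from expanding to unary nats. *)
Definition L14_6 (n : nat) : int :=
  \sum_(x \in @reps 6 n)
    (8019%:R * x`_0 ^+ 8 - 12474%:R * n%:Z * x`_0 ^+ 6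
     + 5670%:R * n%:Z ^+ 2 * x`_0 ^+ 4 - 756 * n%:Z ^+ 3 * x`_0 ^+ 2
     + 14 * n%:Z ^+ 4).

Definition conv (f : nat -> nat) (g : nat -> int) (n : nat) : int :=
  \sum_(p \in [set p : nat * nat | [/\ (0 < p.1)%N, (0 < p.2)%N
                                     & (p.1 + p.2)%N = n]])
    ((f p.1)%:Z * g p.2).

Lemma convE (f : nat -> nat) (g : nat -> int) (n : nat) :
  conv f g n = \sum_(1 <= a < n) (f a)%:Z * g (n - a)%N.
Proof.
rewrite /conv (fsbig_fwiden [seq (a, n - a)%N | a <- index_iota 1 n]).
- by rewrite big_map.
- move=> [a b] /= [a_gt0 b_gt0 <-]; apply/mapP; exists a.
    by rewrite mem_index_iota; lia.
  by rewrite addKn.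
- by rewrite map_inj_uniq ?iota_uniq // => a b [].
- move=> p [/= /mapP[a]]; rewrite mem_index_iota => an -> /= notP.
  by exfalso; apply: notP; split=> /=; lia.
Qed.

(* Main.v *)
(* Let a = sum q^(m^2 + m n + n^2) and D = q d/dq. By the symmetries of the hexagonal
   lattice, the generating functions of the sums L are polynomials in a, its
   derivatives, and one sextic moment. Two rearrangements of lattice sums replace the
   theory of modular forms. Multiplying the two-variable theta function of the
   hexagonal lattice by Jacobi's theta function sum (-1)^k q^(k(k+1)/2) z^(2k+1) and
   completing squares separates the variables and leaves pentagonal series; and the
   logarithmic derivative in z of Jacobi's theta function is a Lambert series. At
   z = 1 the derivatives in z turn into powers of D (heat equation), so comparing
   Taylor coefficients gives Ramanujan's differential equations for E2, E4, E6, the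
   identity E8 = E4^2, the equation 6 a'' = 2 E2 a' - E2' a, and the sextic moment.
   Uniqueness of power series solutions then yields E4 = a^4 + 8 a c^3 with
   4 c^3 = 12 a' - a E2 + a^3. The ring generated by a, E2 and c^3 is closed under D
   and contains every series involved, and there the statement is a polynomial
   identity. *)
From HB Require Import structures.
Require Import Defs.
From mathcomp Require Import ring lra zify.

Set Implicit Arguments.
Unset Strict Implicit.
Unset Printing Implicit Defensive.

Import Order.TTheory GRing.Theory Num.Theory.
Local Open Scope classical_set_scope.
Local Open Scope ring_scope.

(** * Integer power series in q *)

(** The wrapper lets series carry the Cauchy product as their ring structure, apart from pointwise
    products of functions. *)
Record fps := Fps { coeff :> nat -> int }.

Lemma fpsP (x y : fps) : x =1 y -> x = y.
Proof. by case: x y => x [y] /= /funext ->. Qed.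

HB.instance Definition _ := gen_eqMixin fps.
HB.instance Definition _ := gen_choiceMixin fps.

Definition fps_add (x y : fps) := Fps (fun n => x n + y n).
Definition fps_opp (x : fps) := Fps (fun n => - x n).
Definition fps_mul (x y : fps) := Fps (fun n => \sum_(i < n.+1) x i * y (n - i)%N).

Lemma fps_addA : associative fps_add.
Proof. by move=> x y z; apply: fpsP => n /=; rewrite addrA. Qed.
Lemma fps_addC : commutative fps_add.
Proof. by move=> x y; apply: fpsP => n /=; rewrite addrC. Qed.
Lemma fps_add0 : left_id (Fps (fun=> 0)) fps_add.
Proof. by move=> x; apply: fpsP => n /=; rewrite add0r. Qed.
Lemma fps_addN : left_inverse (Fps (fun=> 0)) fps_opp fps_add.
Proof. by move=> x; apply: fpsP => n /=; rewrite addNr. Qed.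

HB.instance Definition _ :=
  GRing.isZmodule.Build fps fps_addA fps_addC fps_add0 fps_addN.

Lemma coeffD (x y : fps) n : (x + y) n = x n + y n. Proof. by []. Qed.
Lemma coeffN (x : fps) n : (- x) n = - x n. Proof. by []. Qed.
Lemma coeffB (x y : fps) n : (x - y) n = x n - y n. Proof. by []. Qed.

(** Coefficients of a product below [N] depend only on truncations, so commutativity and
    associativity are inherited from polynomials. *)
Definition trunc (N : nat) (x : fps) : {poly int} := \poly_(i < N) x i.

Lemma coef_trunc_mul (N n : nat) (x y : fps) :
  (n < N)%N -> (trunc N x * trunc N y)`_n = fps_mul x y n.
Proof.
move=> ltnN; rewrite coefM; apply: eq_bigr => -[i /= lti] _.
by rewrite !coef_poly !ifT //; lia.
Qed.

Lemma fps_mulC : commutative fps_mul.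
Proof.
move=> x y; apply: fpsP => n.
by rewrite -!(@coef_trunc_mul n.+1) // mulrC.
Qed.

Lemma fps_mulA : associative fps_mul.
Proof.
move=> x y z; apply: fpsP => n.
transitivity (trunc n.+1 x * trunc n.+1 y * trunc n.+1 z)`_n.
  rewrite -mulrA coefM; apply: eq_bigr => -[i /= lti] _.
  by rewrite coef_trunc_mul ?coef_poly ?ifT //; lia.
rewrite coefM; apply: eq_bigr => -[i /= lti] _.
by rewrite coef_trunc_mul ?coef_poly ?ifT //; lia.
Qed.

Lemma fps_mul1 : left_id (Fps (fun n => (n == 0)%:R)) fps_mul.
Proof.
move=> x; apply: fpsP => n /=; rewrite big_ord_recl /= mul1r subn0.
by rewrite big1 ?addr0 // => i _; rewrite mul0r.
Qed.

Lemma fps_mulDl : left_distributive fps_mul fps_add.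
Proof.
move=> x y z; apply: fpsP => n /=; rewrite -big_split /=.
by apply: eq_bigr => i _; rewrite mulrDl.
Qed.

Lemma fps_1neq0 : Fps (fun n => (n == 0)%:R) != 0.
Proof. by apply/eqP => /(congr1 (fun x : fps => x 0)). Qed.

HB.instance Definition _ :=
  GRing.Zmodule_isComNzRing.Build fps fps_mulA fps_mulC fps_mul1 fps_mulDl fps_1neq0.

Lemma coeff1 n : (1 : fps) n = (n == 0)%:R. Proof. by []. Qed.
Lemma coeffM (x y : fps) n : (x * y) n = \sum_(i < n.+1) x i * y (n - i)%N.
Proof. by []. Qed.

Lemma coeffM0 (x y : fps) : (x * y) 0 = x 0 * y 0.
Proof. by rewrite coeffM big_ord_recl big_ord0 addr0. Qed.

Lemma coeffMn (x : fps) k n : (x *+ k) n = x n *+ k.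
Proof. by elim: k => // k IH; rewrite !mulrS coeffD IH. Qed.

Lemma coeff_nat k n : (k%:R : fps) n = k%:R *+ (n == 0).
Proof. by rewrite coeffMn coeff1 -!mulrnA mulnC. Qed.

Lemma coeffMnat k (x : fps) n : (k%:R * x) n = k%:R * x n.
Proof. by rewrite !mulr_natl coeffMn. Qed.

Lemma coeffX0 (x : fps) k : (x ^+ k) 0 = x 0 ^+ k.
Proof. by elim: k => // k IH; rewrite !exprS coeffM0 IH. Qed.

Definition fpsE0 := (coeffM0, coeffX0, coeffD, coeffN, coeff_nat, coeff1).

(** The cancelled factor is [k.+1], hence nonzero: [fps_natI 3] cancels 4. *)
Lemma fps_natI k (x y : fps) : k.+1%:R * x = k.+1%:R * y -> x = y.
Proof.
move=> E; apply: fpsP => n.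
have := congr1 (fun z : fps => z n) E; rewrite !coeffMnat => /mulfI; apply.
by rewrite pnatr_eq0.
Qed.

Lemma coeffM_lead (x y : fps) n :
  (forall i, (i < n)%N -> y i = 0) -> (x * y) n = x 0 * y n.
Proof.
move=> y0; rewrite coeffM big_ord_recl /= subn0 big1 ?addr0 // => -[i /= lti] _.
by rewrite y0 ?mulr0 // /bump /=; lia.
Qed.

(** The lowest nonzero coefficient of [y - z] would survive multiplication by a series with nonzero
    constant term. *)
Lemma fps_mulI (x y z : fps) : x 0 != 0 -> x * y = x * z -> y = z.
Proof.
move=> x0 /eqP; rewrite -subr_eq0 -mulrBr => /eqP E.
apply/eqP; rewrite -subr_eq0; apply/eqP; move: (y - z) E => {y z} w E.
apply: fpsP; elim/ltn_ind => n IH.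
have := coeffM_lead x IH.
by rewrite E => /esym/eqP; rewrite mulf_eq0 (negPf x0) => /eqP.
Qed.

Definition D (x : fps) := Fps (fun n => n%:Z * x n).

Lemma coeff_D (x : fps) n : D x n = n%:Z * x n. Proof. by []. Qed.

Lemma DD (x y : fps) : D (x + y) = D x + D y.
Proof. by apply: fpsP => n; rewrite !(coeff_D, coeffD) mulrDr. Qed.

Lemma DN (x : fps) : D (- x) = - D x.
Proof. by apply: fpsP => n; rewrite !(coeff_D, coeffN) mulrN. Qed.

Lemma DM (x y : fps) : D (x * y) = D x * y + x * D y.
Proof.
apply: fpsP => n; rewrite coeffD coeff_D !coeffM mulr_sumr -big_split /=.
apply: eq_bigr => -[i /= lti] _.
have -> : n%:Z = i%:Z + (n - i)%N%:Z by lia.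
by ring.
Qed.

Lemma D1 : D 1 = 0.
Proof. by apply: fpsP => -[|n]; rewrite coeff_D coeff1 ?mul0r ?mulr0. Qed.

Lemma Dnat k : D k%:R = 0.
Proof. by apply: fpsP => n; rewrite coeff_D coeff_nat; case: n => [|n]; rewrite ?mul0r ?mulr0. Qed.

Lemma D_natl k (x : fps) : D (k%:R * x) = k%:R * D x.
Proof. by rewrite DM Dnat mul0r add0r. Qed.

Lemma DX (x : fps) n : D (x ^+ n.+1) = n.+1%:R * x ^+ n * D x.
Proof.
elim: n => [|n IH]; first by rewrite !expr1 expr0 !mul1r.
by rewrite exprS DM IH -!natr1 exprS; ring.
Qed.

Lemma D0 : D 0 = 0.
Proof. exact: (Dnat 0). Qed.

Definition DE := (DM, DD, DN, Dnat, D1, D0, DX).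

(** * Power series as sums over index sets *)

Lemma coeffMz (a : int) (x : fps) n : (a%:~R * x) n = a * x n.
Proof.
case: a => k; first by rewrite -[_%:~R]/(k%:R) coeffMnat natz.
by rewrite NegzE mulrNz mulNr coeffN -[_%:~R]/(k.+1%:R) coeffMnat natz mulNr.
Qed.

(* The q-series sum_i c i q^(e i); terms with negative exponent are ignored. *)
Definition qsum (I : choiceType) (e c : I -> int) : fps :=
  Fps (fun n => \sum_(i \in [set i | e i = n%:Z]) c i).

Lemma qsumE (I : choiceType) (e c : I -> int) n :
  qsum e c n = \sum_(i \in [set i | e i = n%:Z]) c i.
Proof. by []. Qed.

Opaque qsum.

(** Sums with infinite support are 0 by convention, so adding and multiplying series termwise
    requires finitely many terms up to each exponent. *)
Definition summable (I : choiceType) (e c : I -> int) :=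
  (forall i, c i != 0 -> 0 <= e i) /\
  forall n : nat, exists r : seq I, forall i, c i != 0 -> e i <= n%:Z -> i \in r.

Section Gs.
Implicit Types I J : choiceType.

Lemma coeff_qsum I (e c : I -> int) n :
  qsum e c n = \sum_(i \in [set: I]) (if e i == n%:Z then c i else 0).
Proof.
rewrite qsumE fsbig_mkcond; apply: eq_fsbigr => i _; rewrite /patch.
by case: eqP => [E|E]; case: ifPn => //; rewrite ?inE ?notin_setE //= => /E.
Qed.

Lemma eq_qsum I (e c e' c' : I -> int) :
  c =1 c' -> (forall i, c i != 0 -> e i = e' i) -> qsum e c = qsum e' c'.
Proof.
move=> cE eE; apply: fpsP => n; rewrite !coeff_qsum; apply: eq_fsbigr => i _.
rewrite -cE; have [->|/eE ->//] := eqVneq (c i) 0.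
by rewrite !if_same.
Qed.

Lemma qsum_seq I (e c : I -> int) n (r : seq I) :
  uniq r -> (forall i, c i != 0 -> e i = n%:Z -> i \in r) ->
  qsum e c n = \sum_(i <- r) (if e i == n%:Z then c i else 0).
Proof.
move=> ur rP; rewrite coeff_qsum -[RHS]big_mkcond /=.
rewrite (bigfs _ ur) => [|i /eqP ei].
  rewrite fsbig_mkcond; apply: eq_fsbigr => i _; rewrite /patch.
  by congr (if _ then _ else _); apply/idP/idP; rewrite inE.
by move=> /negP nr; apply/eqP/negPn/negP => /rP; move/(_ ei).
Qed.

Lemma summable_uniq I (e c : I -> int) n : summable e c ->
  exists2 r : seq I, uniq r & forall i, c i != 0 -> e i <= n%:Z -> i \in r.
Proof.
move=> [_ /(_ n)[r rP]]; exists (undup r); rewrite ?undup_uniq // => i.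
by rewrite mem_undup; apply: rP.
Qed.

Lemma summable_le I (e c e' c' : I -> int) : summable e c ->
  (forall i, c' i != 0 -> c i != 0) -> (forall i, c' i != 0 -> e' i = e i) ->
  summable e' c'.
Proof.
move=> [e_ge0 sP] cP eP; split=> [i c'i|n]; first by rewrite eP // e_ge0 // cP.
have [r rP] := sP n; exists r => i c'i; rewrite eP // => ei.
by apply: rP => //; apply: cP.
Qed.

Lemma qsumD I (e c c' : I -> int) : summable e c -> summable e c' ->
  qsum e (fun i => c i + c' i) = qsum e c + qsum e c'.
Proof.
move=> /summable_uniq sc /summable_uniq sc'; apply: fpsP => n.
have [r _ rP] := sc n; have [r' _ rP'] := sc' n.
have ur := undup_uniq (r ++ r').
rewrite coeffD !(qsum_seq ur) => [|i ci ei|i ci ei|i ci ei].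
- rewrite -big_split; apply: eq_bigr => i _ /=; case: ifP => //.
- by rewrite mem_undup mem_cat rP' ?ei ?orbT.
- by rewrite mem_undup mem_cat rP ?ei.
- rewrite mem_undup mem_cat; have [ci0|/rP->//] := eqVneq (c i) 0; last by rewrite ei.
  by move: ci; rewrite ci0 add0r => /rP' ->; rewrite ?orbT ?ei.
Qed.

Lemma qsumZ I (e c : I -> int) (a : int) :
  qsum e (fun i => a * c i) = a%:~R * qsum e c.
Proof.
apply: fpsP => n; rewrite coeffMz !coeff_qsum mulr_fsumr; apply: eq_fsbigr => i _.
by case: ifP; rewrite ?mulr0.
Qed.

Lemma qsumN I (e c : I -> int) : qsum e (fun i => - c i) = - qsum e c.
Proof.
rewrite -[RHS]mulN1r -[-1]/((-1)%:~R) -qsumZ.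
by apply: eq_qsum => // i; rewrite mulN1r.
Qed.

Lemma qsum0 I (e : I -> int) : qsum e (fun=> 0) = 0.
Proof. by apply: fpsP => n; rewrite coeff_qsum fsbig1 // => i _; rewrite if_same. Qed.

Lemma qsum_sum I (e : I -> int) (K : Type) (r : seq K) (c : K -> I -> int) :
  (forall k, summable e (c k)) ->
  qsum e (fun i => \sum_(k <- r) c k i) = \sum_(k <- r) qsum e (c k).
Proof.
move=> sc; suff: summable e (fun i => \sum_(k <- r) c k i) /\
  qsum e (fun i => \sum_(k <- r) c k i) = \sum_(k <- r) qsum e (c k) by case.
elim: r => [|k r [s IH]].
  split; last by rewrite big_nil -(qsum0 e); apply: eq_qsum => // i; rewrite big_nil.
  by split=> [i|n]; [|exists [::] => i]; rewrite big_nil eqxx.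
split; last first.
  rewrite big_cons -IH -(qsumD (sc k) s); apply: eq_qsum => // i.
  by rewrite big_cons.
split=> [i|n].
  rewrite big_cons; have [->|ck _] := eqVneq (c k i) 0; last exact: (sc k).1.
  by rewrite add0r; apply: s.1.
have [r1 r1P] := (sc k).2 n; have [r2 r2P] := s.2 n; exists (r1 ++ r2) => i.
rewrite big_cons mem_cat; have [->|ck _] := eqVneq (c k i) 0.
  by rewrite add0r => ? ?; rewrite r2P ?orbT.
by move=> ?; rewrite r1P.
Qed.

Lemma D_qsum I (e c : I -> int) : D (qsum e c) = qsum e (fun i => e i * c i).
Proof.
apply: fpsP => n; rewrite coeff_D !coeff_qsum mulr_fsumr; apply: eq_fsbigr => i _.
by case: eqP => [->|]; rewrite ?mulr0.
Qed.

Lemma qsum_reindex I J (h : I -> J) (e c : J -> int) :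
  injective h -> (forall j, c j != 0 -> exists i, h i = j) ->
  qsum e c = qsum (e \o h) (c \o h).
Proof.
move=> hi hs; apply: fpsP => n; rewrite !qsumE.
rewrite -(fsbig_image [set i | e (h i) = n%:Z] h c); last by move=> i j _ _ /hi.
apply/esym/fsbig_widen => [j [i /= ei <-] //|j /= [ej nj]].
apply/eqP/negPn/negP => /hs [i ij]; apply: nj; exists i => //=.
by rewrite ij.
Qed.

Lemma summable_reindex I J (h : I -> J) (e c : J -> int) :
  (forall j, c j != 0 -> exists i, h i = j) ->
  summable (e \o h) (c \o h) -> summable e c.
Proof.
move=> hs [e0 sP]; split=> [j cj|n]; first by have [i hij] := hs j cj; rewrite -hij e0 //= hij.
have [r rP] := sP n; exists (map h r) => j cj ej.
by have [i hij] := hs j cj; rewrite -hij; apply/map_f/rP; rewrite /= hij.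
Qed.

(** A sign-reversing involution that keeps exponents makes the series equal to its own negative. *)
Lemma qsum_antisym I (h : I -> I) (e c : I -> int) :
  involutive h -> (forall i, c (h i) = - c i) ->
  (forall i, c i != 0 -> e (h i) = e i) -> qsum e c = 0.
Proof.
move=> hK ch eh; apply: (@fps_natI 1); rewrite mulr0.
have : qsum e c = - qsum e c.
  rewrite {1}(qsum_reindex e (inv_inj hK)) => [|j _]; last by exists (h j).
  rewrite -qsumN; apply: eq_qsum => i /=; first exact: ch.
  by rewrite ch oppr_eq0; apply: eh.
by move=> E; rewrite mulr_natl mulr2n {1}E addNr.
Qed.

Lemma summableM I J (e c : I -> int) (e' c' : J -> int) :
  summable e c -> summable e' c' ->
  summable (fun p : I * J => e p.1 + e' p.2) (fun p => c p.1 * c' p.2).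
Proof.
move=> [e0 sc] [e0' sc']; split=> [p|n].
  by rewrite mulf_eq0 negb_or => /andP[? ?]; rewrite addr_ge0 ?e0 ?e0'.
have [r rP] := sc n; have [r' rP'] := sc' n.
exists [seq (i, j) | i <- r, j <- r'] => -[i j] /=.
rewrite mulf_eq0 negb_or => /andP[ci cj] le_n.
have := e0 _ ci; have := e0' _ cj => *.
by rewrite allpairs_f // ?rP ?rP' //; lia.
Qed.

(** A pair of indices [(i, j)] meets the Cauchy product only in its term of index [e i]. *)
Lemma qsumM I J (e c : I -> int) (e' c' : J -> int) :
  summable e c -> summable e' c' ->
  qsum e c * qsum e' c' = qsum (fun p : I * J => e p.1 + e' p.2) (fun p => c p.1 * c' p.2).
Proof.
move=> sc sc'; apply: fpsP => n; rewrite coeffM.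
have [r ur rP] := summable_uniq n sc; have [r' ur' rP'] := summable_uniq n sc'.
have e0 := sc.1; have e0' := sc'.1.
rewrite (@qsum_seq _ _ _ _ [seq (i, j) | i <- r, j <- r']); last 2 first.
- by rewrite allpairs_uniq // => -[? ?] [? ?] _ _ /= [-> ->].
- move=> [i j] /=; rewrite mulf_eq0 negb_or => /andP[ci cj] le_n.
  have := e0 _ ci; have := e0' _ cj => *.
  by rewrite allpairs_f // ?rP ?rP' //; lia.
rewrite big_allpairs /=.
transitivity (\sum_(k < n.+1) \sum_(i <- r) \sum_(j <- r')
   (if (e i == k%:Z) && (e' j == (n - k)%N%:Z) then c i * c' j else 0)).
  apply: eq_bigr => k _; have ltk := ltn_ord k.
  rewrite (qsum_seq ur) => [|i ci ei]; last by rewrite rP // ei; lia.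
  rewrite (qsum_seq ur') => [|j cj ej]; last by rewrite rP' // ej; lia.
  rewrite mulr_suml; apply: eq_bigr => i _; rewrite mulr_sumr.
  by apply: eq_bigr => j _; case: eqP; case: eqP; rewrite ?mulr0 ?mul0r.
rewrite exchange_big; apply: eq_bigr => i _ /=.
rewrite exchange_big; apply: eq_bigr => j _ /=.
have [->|ci] := eqVneq (c i) 0; first by rewrite mul0r if_same big1 // => k _; rewrite if_same.
have [->|cj] := eqVneq (c' j) 0; first by rewrite mulr0 if_same big1 // => k _; rewrite if_same.
have ei := e0 _ ci; have ej := e0' _ cj.
case: (eqVneq (e i + e' j)) => [En|nE]; last first.
  rewrite big1 // => -[k /= ltk] _; case: eqP => //= Ei; case: eqP => //= Ej.
  by case/eqP: nE; lia.
have ltk : (`|e i| < n.+1)%N by lia.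
rewrite (bigD1 (Ordinal ltk)) //= big1 ?addr0 => [|[k /= ltk'] nk].
  by rewrite !ifT //; apply/andP; split; apply/eqP; lia.
case: eqP => //= Ek; case/eqP: nk; apply: val_inj => /=; lia.
Qed.

Lemma qsum_fiber I J (e : I -> int) (c : I -> J -> int) (r : I -> seq J) :
  (forall i, uniq (r i)) -> (forall i j, c i j != 0 -> j \in r i) ->
  summable (fun p : I * J => e p.1) (fun p => c p.1 p.2) ->
  qsum (fun p : I * J => e p.1) (fun p => c p.1 p.2) =
  qsum e (fun i => \sum_(j <- r i) c i j).
Proof.
move=> ur rP s; apply: fpsP => n; have [U _ UP] := summable_uniq n s.
pose V := undup (map fst U); have uV : uniq V := undup_uniq _.
have VP i j : c i j != 0 -> e i = n%:Z -> i \in V.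
  move=> cij ei; have /(map_f fst) : (i, j) \in U by apply: UP => //=; rewrite ei.
  by rewrite mem_undup.
rewrite (qsum_seq uV) => [|i ci ei]; last first.
  have [j cij] : exists j, c i j != 0.
    apply/not_existsP => c0; case/eqP: ci; rewrite big1 // => j _.
    by apply/eqP/negPn/negP/c0.
  exact: VP cij ei.
rewrite (@qsum_seq _ _ _ _ [seq (i, j) | i <- V, j <- r i]).
- rewrite big_allpairs_dep /=; apply: eq_bigr => i _; case: ifP => // _.
  by rewrite big1.
- by apply: allpairs_uniq_dep => // -[? ?] [? ?] _ _ /= [-> ->].
- by move=> [i j] /= cij ei; apply: allpairs_f_dep; [exact: VP cij ei|exact: rP].
Qed.

End Gs.

Definition zbox (n : nat) : seq int := [seq k%:Z - n%:Z | k <- iota 0 (2 * n).+1].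

Lemma mem_zbox (n : nat) (x : int) : `|x| <= n%:Z -> x \in zbox n.
Proof.
move=> h; apply/mapP; exists `|(x + n%:Z)%R|%N; rewrite ?mem_iota; lia.
Qed.

(** * The hexagonal lattice against the theta function *)

(** The sign [(-1)^k] for [k] of either sign, in a form suited to linear integer arithmetic. *)
Definition altsgn (k : int) : int := 1 - 2 * (k %% 2)%Z.

Lemma altsgnD j k : altsgn (j + k) = altsgn j * altsgn k.
Proof.
rewrite /altsgn; have [j0|j1] : (j %% 2)%Z = 0 \/ (j %% 2)%Z = 1 by lia.
  by rewrite j0 mulr0 subr0 mul1r; lia.
by rewrite j1; lia.
Qed.

Definition tri (k : int) : int := (k * (k + 1) %/ 2)%Z.

Lemma tri2 k : 2 * tri k = k * (k + 1).
Proof.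
have E : (k * (k + 1) %% 2)%Z = 0.
  have [k0|k1] : (exists l, k = 2 * l) \/ (exists l, k = 2 * l + 1).
  - have [?|?] : (k %% 2)%Z = 0 \/ (k %% 2)%Z = 1 by lia.
      by left; exists (k %/ 2)%Z; lia.
    by right; exists (k %/ 2)%Z; lia.
  - by case: k0 => l ->; rewrite -mulrA modzMr.
  - by case: k1 => l ->; rewrite -addrA mulrC (_ : 2 * l + (1 + 1) = 2 * (l + 1)) -?mulrA ?modzMr //; ring.
by rewrite /tri [RHS](divz_eq _ 2) E addr0 mulrC.
Qed.

(** Doubling clears the division in [tri], after which exponents can be compared by [ring]. *)
Lemma double_inj (x y : int) : 2 * x = 2 * y -> x = y.
Proof. lia. Qed.

(** The generalized pentagonal number [l(3l+1)/2]. *)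
Definition pent (l : int) : int := l ^+ 2 + tri l.

Definition nform (p : int * int) : int := p.1 ^+ 2 + p.1 * p.2 + p.2 ^+ 2.

Lemma nform_ge0 p : 0 <= nform p.
Proof. by rewrite /nform; nia. Qed.

Lemma tri_ge0 k : 0 <= tri k.
Proof. by have := tri2 k; nia. Qed.

Lemma pent_ge0 k : 0 <= pent k.
Proof. by rewrite addr_ge0 ?sqr_ge0 ?tri_ge0. Qed.

Lemma summable_nform c : summable nform c.
Proof.
split=> [p _|n]; first exact: nform_ge0.
exists [seq (x, y) | x <- zbox (2 * n), y <- zbox (2 * n)] => -[x y] _ le_n.
have /andP[? ?] := form_bound (le_n : x ^+ 2 + x * y + y ^+ 2 <= n%:Z).
have /andP[? ?] : - (2 * n)%N%:Z <= y <= (2 * n)%N%:Z.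
  by apply: (@form_bound y x); move: le_n; rewrite /nform /=; lia.
by apply: allpairs_f; apply: mem_zbox; lia.
Qed.

Lemma summable_tri c : summable tri c.
Proof.
split=> [p _|n]; first exact: tri_ge0.
exists (zbox (2 * n).+1) => k _ le_n; apply: mem_zbox.
by have := tri2 k; nia.
Qed.

Lemma summable_pent c : summable pent c.
Proof.
split=> [p _|n]; first exact: pent_ge0.
exists (zbox n) => k _ le_n; apply: mem_zbox.
by have := tri_ge0 k; move: le_n; rewrite /pent; nia.
Qed.

(** In [theta] and [penta] the function [g] stands for [x |-> z^x]. Choosing [x^p] instead gives, up
    to factorials, the Taylor coefficients in [log z] at [z = 1], so no second variable is
    needed. *)
Definition lat (g : int -> int -> int) := qsum nform (fun p => g p.1 p.2).
Definition theta (g : int -> int) := qsum tri (fun k => altsgn k * g (2 * k + 1)).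
Definition penta (g : int -> int) := qsum pent (fun l => altsgn l * g (6 * l + 1)).

Lemma theta_even g : (forall x, g (- x) = g x) -> theta g = 0.
Proof.
move=> g_even; apply: (@qsum_antisym _ (fun k => -1 - k)) => [k|k|k _].
- by ring.
- have -> : 2 * (-1 - k) + 1 = - (2 * k + 1) by ring.
  rewrite g_even -mulNr; congr (_ * _); rewrite /altsgn; lia.
- by have := tri2 (-1 - k); have := tri2 k; lia.
Qed.

Section LatticeTimesTheta.
Variable g : int -> int.
Hypothesis g_odd : forall x, g (- x) = - g x.

Let I := (int * int * int)%type.
Let e (p : I) : int := nform p.1 + tri p.2.
Let k (p : I) : int := p.1.1 - p.1.2 + p.2.
Let c (r : int) (p : I) : int :=
  if (k p %% 3)%Z == r then altsgn p.2 * g (2 * k p + 1) else 0.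

Let summable_e c' : summable e c'.
Proof.
apply: (summable_le (summableM (summable_nform (fun=> 1)) (summable_tri (fun=> 1)))) => //.
Qed.

(* Completing squares in the coordinates adapted to k = 3 l separates the variables. *)
Let class0 : qsum e (c 0) = penta (fun=> 1) * penta (fun=> 1) * penta g.
Proof.
pose h (p : I) : I := (p.2 - p.1.1, p.1.2 - p.2, p.2 + p.1.1 + p.1.2).
have kh p : k (h p) = 3 * p.2 by rewrite /k /h /=; ring.
rewrite (qsum_reindex (h := h)); first last.
- move=> [[m n] j]; rewrite /c; case: ((k _ %% 3)%Z =P 0) => [k0 _|]; last by rewrite eqxx.
  exists ((k (m, n, j) %/ 3)%Z - m, n + (k (m, n, j) %/ 3)%Z, (k (m, n, j) %/ 3)%Z).
  by rewrite /h /=; congr (_, _, _); move: k0; rewrite /k /=; lia.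
- by move=> [[m n] j] [[m' n'] j'] [] ? ? ?; congr (_, _, _); lia.
pose c1 l := altsgn l * 1; pose cg l := altsgn l * g (6 * l + 1).
rewrite -[penta (fun=> 1)]/(qsum pent c1) -[penta g]/(qsum pent cg).
have s1 := summable_pent c1.
rewrite (qsumM s1 s1) (qsumM (summableM s1 s1) (summable_pent cg)).
apply: eq_qsum => [p|p _] /=.
  rewrite /c kh modzMr eqxx (_ : 2 * (3 * p.2) + 1 = 6 * p.2 + 1); last by ring.
  by rewrite /h /c1 /cg /= !altsgnD; ring.
case: p => [[m n] j]; rewrite /e /h /nform /pent /=.
by apply: double_inj; rewrite !mulrDr !tri2; ring.
Qed.

(** Exchanging [m] and [n] and sending [j] to [-1-j] turns [k] into [-1-k]. The sign changes of
    [altsgn] and of the odd function [g] cancel. *)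
Let class2 : qsum e (c 2) = qsum e (c 0).
Proof.
pose h (p : I) : I := (p.1.2, p.1.1, -1 - p.2).
have hK : involutive h by move=> [[m n] j]; congr (_, _, _) => /=; ring.
rewrite (qsum_reindex (h := h) e (inv_inj hK)) => [|p _]; last by exists (h p).
have kh p : k (h p) = -1 - k p by rewrite /k /h /=; ring.
apply: eq_qsum => [p|p _] /=.
  rewrite /c kh (_ : ((-1 - k p) %% 3)%Z == 2 = ((k p %% 3)%Z == 0)); last lia.
  case: ifP => // _; have -> : 2 * (-1 - k p) + 1 = - (2 * k p + 1) by ring.
  rewrite g_odd mulrN -mulNr; congr (_ * _); rewrite /h /altsgn /=; lia.
rewrite /e /h /nform /=.
by apply: double_inj; rewrite !mulrDr !tri2; ring.
Qed.

(* The reflection fixing k and n changes the parity of j. *)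
Let class1 : qsum e (c 1) = 0.
Proof.
pose l p := ((k p - 1) %/ 3)%Z.
pose h (p : I) : I := (2 * l p + 1 - p.1.1, p.1.2, p.2 + 2 * p.1.1 - 2 * l p - 1).
have kh p : k (h p) = k p by rewrite /k /h /=; ring.
have lh p : l (h p) = l p by rewrite /l kh.
apply: (@qsum_antisym _ h) => [p|p|p].
- by rewrite {1}/h lh; case: p => [[m n] j]; congr (_, _, _) => /=; ring.
- rewrite /c kh; case: ifP => _; rewrite ?oppr0 // -mulNr; congr (_ * _).
  by rewrite /h /altsgn /=; lia.
- rewrite /c; case: ((k _ %% 3)%Z =P 1) => [k1 _|]; last by rewrite eqxx.
  have : k p = 3 * l p + 1 by rewrite /l; lia.
  rewrite /e /h /nform; move: (l p) => l0 {k1}; case: p => [[m n] j]; rewrite /k /= => kl.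
  have -> : j = 3 * l0 + 1 - m + n by lia.
  by apply: double_inj; rewrite !mulrDr !tri2; ring.
Qed.

(** The residue classes 0 and 2 of [k] modulo 3 contribute equally and class 1 contributes nothing,
    whence the factor 2. *)
Lemma lat_theta :
  qsum (fun p : int * int * int => nform p.1 + tri p.2)
     (fun p => altsgn p.2 * g (2 * (p.1.1 - p.1.2) + (2 * p.2 + 1)))
  = 2%:R * (penta (fun=> 1) * penta (fun=> 1) * penta g).
Proof.
transitivity (qsum e (fun p => c 0 p + c 1 p + c 2 p)).
  apply: eq_qsum => // p; rewrite /c.
  have -> : 2 * (p.1.1 - p.1.2) + (2 * p.2 + 1) = 2 * k p + 1 by rewrite /k; ring.
  have [->|[->|->]] : (k p %% 3)%Z = 0 \/ (k p %% 3)%Z = 1 \/ (k p %% 3)%Z = 2 by lia.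
  - by rewrite eqxx !addr0.
  - by rewrite eqxx add0r addr0.
  - by rewrite eqxx !add0r.
rewrite !qsumD // class1 class2 class0; ring.
Qed.

End LatticeTimesTheta.

(** The binomial expansion of [(2(m-n) + (2j+1))^p] separates the lattice from the theta series. *)
Lemma lat_theta_pow (p : nat) : odd p ->
  \sum_(i < p.+1) 'C(p, i)%:R *
    (lat (fun m n => (2 * (m - n)) ^+ (p - i)) * theta (fun x => x ^+ i))
  = 2%:R * (penta (fun=> 1) * penta (fun=> 1) * penta (fun x => x ^+ p)).
Proof.
move=> p_odd; rewrite -lat_theta; last by move=> x; rewrite exprNn -signr_odd p_odd expr1 mulN1r.
under eq_bigr => i _ do rewrite (qsumM (summable_nform _) (summable_tri _)) -[_%:R]/('C(p, i)%:Z%:~R) -qsumZ.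
rewrite -qsum_sum => [|i].
  apply: eq_qsum => // -[[m n] j] /=; rewrite exprDn mulr_sumr; apply: eq_bigr => i _.
  by rewrite -mulr_natl natz; ring.
apply: (summable_le (summableM (summable_nform (fun=> 1)) (summable_tri (fun=> 1)))) => //.
Qed.

(** * The logarithmic derivative of the theta function *)

Lemma summable_triN (c : nat -> int) : summable (fun k : nat => tri k%:Z) c.
Proof.
split=> [k _|n]; first exact: tri_ge0.
exists (iota 0 (2 * n).+1) => k _ le_n; rewrite mem_iota.
by have := tri2 k%:Z; nia.
Qed.

Definition half_theta (g : nat -> int) := qsum (fun k : nat => tri k%:Z) (fun k => altsgn k%:Z * g k).

(** For odd [g] the terms at [k] and [-1-k] agree. *)
Lemma theta_odd (g : int -> int) : (forall x, g (- x) = - g x) ->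
  theta g = 2%:R * half_theta (fun k => g (2 * k%:Z + 1)).
Proof.
move=> g_odd; pose c (b : int -> bool) k := if b k then altsgn k * g (2 * k + 1) else 0.
have cP : qsum tri (c (fun k => 0 <= k)) = half_theta (fun k => g (2 * k%:Z + 1)).
  rewrite (qsum_reindex (h := Posz)) => [||k]; last 2 first.
  - by move=> ? ? [].
  - by rewrite /c; case: ifP => [k0 _|]; [exists `|k|%N; lia|rewrite eqxx].
  exact: eq_qsum.
have cN : qsum tri (c (fun k => k < 0)) = qsum tri (c (fun k => 0 <= k)).
  have hK : involutive (fun k : int => -1 - k) by move=> k; ring.
  rewrite (qsum_reindex tri (inv_inj hK)) => [|k _]; last by exists (-1 - k); ring.
  apply: eq_qsum => [k|k _] /=; last by have := tri2 (-1 - k); have := tri2 k; lia.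
  rewrite /c (_ : (-1 - k < 0) = (0 <= k)); last lia.
  case: ifP => // _; have -> : 2 * (-1 - k) + 1 = - (2 * k + 1) by ring.
  rewrite g_odd mulrN -mulNr; congr (_ * _); rewrite /altsgn /=; lia.
transitivity (qsum tri (fun k => c (fun k => 0 <= k) k + c (fun k => k < 0) k)).
  by apply: eq_qsum => // k; rewrite /c ltNge; case: ifP; rewrite ?addr0 ?add0r.
by rewrite (qsumD (summable_tri _) (summable_tri _)) cN cP mulr_natl mulr2n.
Qed.

(** A Lambert series: the coefficient of [q^n] sums [g] over the divisors of [n]. Both indices are
    shifted by one to make the factors positive. *)
Definition divsum (g : nat -> int) :=
  qsum (fun p : nat * nat => (p.1.+1 * p.2.+1)%N%:Z) (fun p => g p.2.+1).

Lemma summable_divsum (c : nat * nat -> int) :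
  summable (fun p : nat * nat => (p.1.+1 * p.2.+1)%N%:Z) c.
Proof.
split=> // n; exists [seq (x, y) | x <- iota 0 n, y <- iota 0 n] => -[x y] _ le_n.
by apply: allpairs_f; rewrite mem_iota; move: le_n => /=; nia.
Qed.

(* The Lambert series of the logarithmic derivative, times theta: in the coordinates
   (i, n, m) with i = k + m, the points with i < 0 cancel those with n > 2 i + 1,
   the line n = 2 i + 1 contributes theta again, and for i < n <= 2 i the sum over
   all integers m vanishes, which leaves minus the term m = 0. *)
Section LogarithmicDerivative.
Variable g : int -> int.
Hypothesis g_even : forall x, g (- x) = g x.

Let J := (int * int * int)%type.
Let e (p : J) : int := tri (p.1.1 - p.2) + p.1.2 * p.2.
Let c (b : J -> bool) (p : J) : int :=
  if b p then altsgn (p.1.1 - p.2) * g (2 * p.1.1 + 1) else 0.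

Let bW (p : J) := (1 <= p.1.2) && (1 <= p.2).

Definition theta_div :=
  qsum (fun p : int * (nat * nat) => tri p.1 + (p.2.1.+1 * p.2.2.+1)%N%:Z)
     (fun p => altsgn p.1 * g (2 * p.1 + 1 + 2 * p.2.2.+1%:Z)).

Let hW (p : int * (nat * nat)) : J := (p.1 + p.2.2.+1%:Z, p.2.1.+1%:Z, p.2.2.+1%:Z).

Let hW_surj p : c bW p != 0 -> exists i, hW i = p.
Proof.
rewrite /c; case: ifP => [|_]; last by rewrite eqxx.
case: p => [[i n] m] /andP[/= n1 m1] _; exists (i - m, (`|n|.-1, `|m|.-1)%N).
by rewrite /hW /=; congr (_, _, _); lia.
Qed.

Let e_hW p : e (hW p) = tri p.1 + (p.2.1.+1 * p.2.2.+1)%N%:Z.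
Proof. by rewrite /e /hW /= addrK PoszM. Qed.

Let theta_divE : theta_div = qsum e (c bW).
Proof.
rewrite (qsum_reindex (h := hW)) //; last first.
  by move=> [k [n m]] [k' [n' m']] [] ? ? ?; congr (_, (_, _)); lia.
apply: eq_qsum => [p|p _] /=; last by rewrite e_hW.
rewrite /c /bW /hW /= addrK; congr (_ * g _); ring.
Qed.

Let summableW : summable e (c bW).
Proof.
apply: (summable_reindex hW_surj).
apply: (summable_le (summableM (summable_tri (fun=> 1)) (summable_divsum (fun=> 1)))) => //.
by move=> p _ /=; rewrite e_hW.
Qed.

Let sub_summable (b b' : J -> bool) : (forall p, b' p -> b p) -> summable e (c b) -> summable e (c b').
Proof.
move=> bP s; apply: (summable_le s) => // p; rewrite /c.
by case: ifP => [/bP ->|]; rewrite ?eqxx.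
Qed.

Let split_gs (b b1 b2 : J -> bool) : (forall p, b1 p -> b p) -> (forall p, b2 p = b p && ~~ b1 p) ->
  summable e (c b) -> qsum e (c b) = qsum e (c b1) + qsum e (c b2).
Proof.
move=> b1P b2P s; rewrite -qsumD.
- by apply: eq_qsum => // p; rewrite /c b2P; have := b1P p;
    case: (b1 p) => [->|_] //; rewrite ?addr0 // andbT add0r.
- exact: sub_summable s.
- by apply: sub_summable s => p; rewrite b2P => /andP[].
Qed.

Let b1 (p : J) := [&& 0 <= p.1.1, 1 <= p.1.2, p.1.2 <= 2 * p.1.1 + 1 & 1 <= p.2].
Let b2 (p : J) := [&& 0 <= p.1.1, 2 * p.1.1 + 1 < p.1.2 & 1 <= p.2].
Let b3 (p : J) := [&& p.1.1 < 0, 1 <= p.1.2 & 1 <= p.2].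
Let b23 (p : J) := bW p && ~~ b1 p.

(** The map [i -> -1-i], [n -> n-2i-1] keeps the exponent and flips the sign. *)
Let qsum_b3 : qsum e (c b3) = - qsum e (c b2).
Proof.
pose h (p : J) : J := (-1 - p.1.1, p.1.2 - (2 * p.1.1 + 1), p.2).
have hK : involutive h by move=> [[i n] m]; congr (_, _, _) => /=; ring.
rewrite (qsum_reindex e (inv_inj hK)) => [|p _]; last by exists (h p).
rewrite -qsumN; apply: eq_qsum => [[[i n] m]|[[i n] m] _] /=; last first.
  by rewrite /e /h /=; apply: double_inj; rewrite !mulrDr !tri2; ring.
rewrite /c (_ : b3 (h (i, n, m)) = b2 (i, n, m)); last by rewrite /b2 /b3 /h /=; lia.
case: ifP => // _; rewrite -mulNr /h /=; congr (_ * _); first by rewrite /altsgn; lia.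
by rewrite -g_even; congr g; ring.
Qed.

Let qsum_W : qsum e (c bW) = qsum e (c b1).
Proof.
have b1W p : b1 p -> bW p by rewrite /b1 /bW; lia.
have s23 : summable e (c b23) by apply: sub_summable summableW => p /andP[].
rewrite (split_gs b1W (b2 := b23)) // (@split_gs b23 b2 b3) //.
- by rewrite qsum_b3 subrr addr0.
- by move=> p; rewrite /b23 /b2 /bW /b1; lia.
- by move=> p; rewrite /b23 /b3 /b2 /bW /b1; lia.
Qed.

Let b11 (p : J) := [&& 0 <= p.1.1, p.1.2 == 2 * p.1.1 + 1 & 1 <= p.2].
Let b10 (p : J) := [&& p.1.1 < p.1.2, p.1.2 <= 2 * p.1.1 & p.2 == 0].
Let b12 (p : J) := [&& 1 <= p.1.2, p.1.2 <= p.1.1 & 1 <= p.2].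
Let b12' (p : J) := [&& p.1.1 < p.1.2, p.1.2 <= 2 * p.1.1 & p.2 < 0].
Let b13 (p : J) := [&& p.1.1 < p.1.2, p.1.2 <= 2 * p.1.1 & 1 <= p.2].
Let b1' (p : J) := b1 p && ~~ b11 p.
Let ball (p : J) := (p.1.1 < p.1.2) && (p.1.2 <= 2 * p.1.1).
Let ball' (p : J) := ball p && ~~ b10 p.

(** The map [n -> 2i+1-n], [m -> -m] moves the part [n <= i] to negative [m]. Together with [b13] it
    then fills the strip [i < n <= 2i] except for [m = 0]. *)
Let qsum_b12 : qsum e (c b12) = qsum e (c b12').
Proof.
pose h (p : J) : J := (p.1.1, 2 * p.1.1 + 1 - p.1.2, - p.2).
have hK : involutive h by move=> [[i n] m]; congr (_, _, _) => /=; ring.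
rewrite (qsum_reindex e (inv_inj hK)) => [|p _]; last by exists (h p).
apply: eq_qsum => [[[i n] m]|[[i n] m] _] /=; last first.
  by rewrite /e /h /=; apply: double_inj; rewrite !mulrDr !tri2; ring.
rewrite /c (_ : b12 (h (i, n, m)) = b12' (i, n, m)); last by rewrite /b12 /b12' /h /=; lia.
by case: ifP => // _; rewrite /h /=; congr (_ * _); rewrite /altsgn; lia.
Qed.

(** For fixed [i] and [n] the exponent is quadratic in [m]. Reflection in its axis preserves it and
    changes the parity of [m]. *)
Let qsum_ball : qsum e (c ball) = 0.
Proof.
apply: (@qsum_antisym _ (fun p => (p.1, 1 - 2 * (p.1.2 - p.1.1) - p.2))) => [[[i n] m]|[[i n] m]|[[i n] m] _] /=.
- by congr (_, _, _); ring.
- by rewrite /c /ball /=; case: ifP => _; rewrite ?oppr0 // -[RHS]mulNr; congr (_ * _); rewrite /altsgn; lia.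
- by rewrite /e /=; apply: double_inj; rewrite !mulrDr !tri2; ring.
Qed.

Let summable_ball : summable e (c ball).
Proof.
have bnd p : c ball p != 0 -> (0 <= p.1.1 < p.1.2) && (p.1.2 <= 2 * p.1.1) /\
    p.1.1 + `|p.2| <= 2 * e p.
  rewrite /c; case: ifP => [|_]; last by rewrite eqxx.
  case: p => [[i n] m] /andP[/= lt1 le2] _; split; first by lia.
  rewrite /e /= mulrDr tri2; case: (leP 0 m) => m0; first by rewrite ger0_norm //; nia.
  (* For [m < 0] the doubled exponent equals [(i+m)^2 + 2(2i-n)(-m) + i + |m|]. *)
  rewrite ltr0_norm //; have : 0 <= (i + m) ^+ 2 by exact: sqr_ge0.
  have : 0 <= (2 * i - n) * - m by rewrite mulr_ge0 //; lia.
  nia.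
split=> [p /bnd|n]; first by move=> [? ?]; lia.
exists [seq (q, m) | q <- [seq (i, j) | i <- zbox (2 * n), j <- zbox (4 * n)], m <- zbox (2 * n)].
move=> [[i j] m] cb le_n.
have [ij hb] := bnd _ cb.
have {}hb := le_trans hb (ler_wpM2l (isT : 0 <= 2 :> int) le_n).
by apply: allpairs_f; [apply: allpairs_f|]; apply: mem_zbox; move: ij hb => /=; lia.
Qed.

Let qsum_b1 : qsum e (c b1) = qsum e (c b11) - qsum e (c b10).
Proof.
have s1 : summable e (c b1) by apply: sub_summable summableW => p; rewrite /b1 /bW; lia.
have s1' : summable e (c b1') by apply: sub_summable s1 => p /andP[].
have sa : summable e (c ball') by apply: sub_summable summable_ball => p /andP[].
have E1 : qsum e (c b1) = qsum e (c b11) + qsum e (c b1').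
  by apply: split_gs => // p; rewrite /b11 /b1; lia.
have E2 : qsum e (c b1') = qsum e (c b12) + qsum e (c b13).
  by apply: split_gs => // p; rewrite /b1' /b12 /b13 /b11 /b1; lia.
have E3 : qsum e (c ball) = qsum e (c b10) + qsum e (c ball').
  apply: split_gs => [p|//|]; last exact: summable_ball.
  by rewrite /b10 /ball; lia.
have E4 : qsum e (c ball') = qsum e (c b12') + qsum e (c b13).
  by apply: split_gs => // p; rewrite /ball' /b12' /b13 /b10 /ball; lia.
have : qsum e (c ball') = - qsum e (c b10).
  by apply/eqP; rewrite -addr_eq0 addrC -E3 qsum_ball.
by rewrite E1 E2 qsum_b12 -E4 => ->.
Qed.

Let summable_fst (c' : nat -> nat -> int) :
  (forall k i, c' k i != 0 -> i \in iota 0 k) ->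
  summable (fun p : nat * nat => tri p.1%:Z) (fun p => c' p.1 p.2).
Proof.
move=> cP; split=> [p _|n]; first exact: tri_ge0.
have [r rP] := (summable_triN (fun=> 1)).2 n.
exists [seq (k, i) | k <- r, i <- iota 0 k] => -[k i] /= /cP ik le_n.
by apply: allpairs_f_dep => //; apply: rP.
Qed.

(** On the line [n = 2i+1] the exponent is [tri (i+m)]; with [k = i+m] fixed, [i] runs over
    [0 <= i < k]. *)
Let qsum_b11 : qsum e (c b11) = half_theta (fun k => \sum_(i < k) g (2 * i%:Z + 1)).
Proof.
pose h (p : nat * nat) : J := (p.2%:Z, 2 * p.2%:Z + 1, p.1%:Z - p.2%:Z).
pose c' (k i : nat) := if (i < k)%N then altsgn k%:Z * g (2 * i%:Z + 1) else 0.
have c'P k i : c' k i != 0 -> i \in iota 0 k.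
  by rewrite /c' mem_iota; case: ifP; rewrite ?eqxx.
rewrite (qsum_reindex (h := h)); last 2 first.
- by move=> [k i] [k' i'] [] ? ? ?; congr (_, _); lia.
- move=> [[i n] m]; rewrite /c; case: ifP => [/and3P[/= i0 /eqP -> m1] _|]; last by rewrite eqxx.
  by exists (`|(i + m)%R|%N, `|i|%N); rewrite /h /=; congr (_, _, _); lia.
transitivity (qsum (fun p : nat * nat => tri p.1%:Z) (fun p => c' p.1 p.2)).
  apply: eq_qsum => [[k i]|[k i] _] /=; last first.
    by rewrite /e /h /=; apply: double_inj; rewrite !mulrDr !tri2; ring.
  rewrite /c /c' (_ : b11 (h (k, i)) = (i < k)%N); last by rewrite /b11 /h /=; lia.
  by case: ifP => // _; rewrite /h /=; congr (_ * _); rewrite /altsgn; lia.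
rewrite (qsum_fiber (e := fun k : nat => tri k%:Z) (fun k => iota_uniq 0 k) c'P (summable_fst c'P)).
apply: eq_qsum => // k; rewrite mulr_sumr -(big_mkord xpredT (fun i => altsgn k * g (2 * i%:Z + 1))).
rewrite /index_iota subn0 !big_seq; apply: eq_bigr => i.
by rewrite mem_iota /c' => /andP[_ ->].
Qed.

(** For [m = 0] nothing depends on [n], which takes the [k] values from [k+1] to [2k]. *)
Let qsum_b10 : qsum e (c b10) = half_theta (fun k => k%:Z * g (2 * k%:Z + 1)).
Proof.
pose h (p : nat * nat) : J := (p.1%:Z, p.1%:Z + 1 + p.2%:Z, 0).
pose c' (k i : nat) := if (i < k)%N then altsgn k%:Z * g (2 * k%:Z + 1) else 0.
have c'P k i : c' k i != 0 -> i \in iota 0 k.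
  by rewrite /c' mem_iota; case: ifP; rewrite ?eqxx.
rewrite (qsum_reindex (h := h)); last 2 first.
- by move=> [k i] [k' i'] [] ? ?; congr (_, _); lia.
- move=> [[i n] m]; rewrite /c; case: ifP => [/and3P[/= i0 n1 /eqP ->] _|]; last by rewrite eqxx.
  by exists (`|i|%N, `|(n - i - 1)%R|%N); rewrite /h /=; congr (_, _, _); lia.
transitivity (qsum (fun p : nat * nat => tri p.1%:Z) (fun p => c' p.1 p.2)).
  apply: eq_qsum => [[k i]|[k i] _] /=; last first.
    by rewrite /e /h /= subr0 mulr0 addr0.
  rewrite /c /c' (_ : b10 (h (k, i)) = (i < k)%N); last by rewrite /b10 /h /=; lia.
  by case: ifP => // _; rewrite /h /= subr0.
rewrite (qsum_fiber (e := fun k : nat => tri k%:Z) (fun k => iota_uniq 0 k) c'P (summable_fst c'P)).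
apply: eq_qsum => // k; rewrite big_seq (eq_bigr (fun=> altsgn k * g (2 * k%:Z + 1))).
  by rewrite -big_seq big_const_seq count_predT size_iota iter_addr_0 -mulr_natl natz; ring.
by move=> i; rewrite mem_iota /c' => /andP[_ ->].
Qed.

Lemma theta_divP :
  theta_div = half_theta (fun k => \sum_(i < k) g (2 * i%:Z + 1) - k%:Z * g (2 * k%:Z + 1)).
Proof.
rewrite theta_divE qsum_W qsum_b1 qsum_b11 qsum_b10 -qsumN -(qsumD (summable_triN _) (summable_triN _)).
by apply: eq_qsum => // k; rewrite mulrBr.
Qed.

End LogarithmicDerivative.

Lemma theta_div_pow (r : nat) : ~~ odd r ->
  \sum_(i < r.+1) 'C(r, i)%:R *
    (theta (fun x => x ^+ (r - i)) * divsum (fun m => (2 * m%:Z) ^+ i))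
  = half_theta (fun k => \sum_(i < k) (2 * i%:Z + 1) ^+ r - k%:Z * (2 * k%:Z + 1) ^+ r).
Proof.
move=> r_even; rewrite -(@theta_divP (fun x => x ^+ r)); last first.
  by move=> x; rewrite exprNn -signr_odd (negPf r_even) expr0 mul1r.
under eq_bigr => i _ do
  rewrite (qsumM (summable_tri _) (summable_divsum _)) -[_%:R]/('C(r, i)%:Z%:~R) -qsumZ.
rewrite -qsum_sum => [|i].
  apply: eq_qsum => // -[k [n m]] /=; rewrite exprDn mulr_sumr; apply: eq_bigr => i _.
  by rewrite -mulr_natl natz; ring.
apply: (summable_le (summableM (summable_tri (fun=> 1)) (summable_divsum (fun=> 1)))) => //.
Qed.

(** * Moments of the hexagonal lattice *)

Lemma lat_lin (x y : nat) f g :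
  lat (fun m n => x%:Z * f m n + y%:Z * g m n) = x%:R * lat f + y%:R * lat g.
Proof.
rewrite -[x%:R]/(x%:Z%:~R) -[y%:R]/(y%:Z%:~R) /lat -!qsumZ -qsumD //; exact: summable_nform.
Qed.

Lemma lat_nat (x : nat) f : x%:R * lat f = lat (fun m n => x%:Z * f m n).
Proof. by rewrite -[x%:R]/(x%:Z%:~R) /lat -qsumZ. Qed.

Lemma eq_lat f g : (forall m n, f m n = g m n) -> lat f = lat g.
Proof. by move=> fg; apply: eq_qsum => // p; rewrite fg. Qed.

Lemma D_lat g : D (lat g) = lat (fun m n => nform (m, n) * g m n).
Proof. by rewrite /lat D_qsum; apply: eq_qsum => // -[m n]. Qed.

(** This substitution is the rotation of the hexagonal lattice by sixty degrees. *)
Lemma lat_rot g : lat g = lat (fun m n => g (- n) (m + n)).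
Proof.
pose h (p : int * int) := (- p.2, p.1 + p.2).
rewrite /lat (qsum_reindex (h := h)).
- by apply: eq_qsum => // -[m n] _; rewrite /nform /h /=; ring.
- by move=> [m n] [m' n'] [] ? ?; congr (_, _); lia.
- by move=> [m n] _; exists (m + n, - m); rewrite /h /=; congr (_, _); ring.
Qed.

Definition a2 := lat (fun _ _ => 1).
Definition moment j := lat (fun m _ => m ^+ j).
Definition root_moment j := lat (fun m n => (m - n) ^+ j).
(** The invariants of the hexagonal symmetry group are generated by [nform] and this square. Hence
    it first enters the moments in degree 6. *)
Definition sextic := lat (fun m n => (m * n * (m + n)) ^+ 2).
Definition mu j := half_theta (fun k => (2 * k%:Z + 1) ^+ j).
Definition nu j := penta (fun x => x ^+ j).
Definition sigma_gf i := divsum (fun m => m%:Z ^+ i).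

(** Averaging over the rotations of order three turns power moments into polynomials in [nform] and
    the sextic invariant. *)
Lemma lat_sum3 f : (forall m n, f (- m) (- n) = f m n) ->
  3%:R * lat f = lat (fun m n => f m n + (f (- n) (m + n) + f (m + n) (- m))).
Proof.
move=> f_even; pose f1 m n := f (- n) (m + n); pose f2 m n := f1 (- n) (m + n).
have E1 : lat f = lat f1 := lat_rot f.
have E2 : lat f = lat f2 by rewrite E1; exact: lat_rot.
transitivity (1%:R * lat f + 1%:R * (1%:R * lat f1 + 1%:R * lat f2)).
  by rewrite -E1 -E2; ring.
rewrite -!lat_lin; apply: eq_lat => m n; rewrite !mul1r /f1 /f2 /f1.
by congr (_ + (_ + _)); rewrite -f_even; congr f; ring.
Qed.

Lemma D1_a2 : D a2 = lat (fun m n => nform (m, n)).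
Proof. by rewrite D_lat; apply: eq_lat => m n; rewrite mulr1. Qed.

Lemma D2_a2 : D (D a2) = lat (fun m n => nform (m, n) ^+ 2).
Proof. by rewrite D1_a2 D_lat. Qed.

Lemma D3_a2 : D (D (D a2)) = lat (fun m n => nform (m, n) ^+ 3).
Proof. by rewrite D2_a2 D_lat. Qed.

Lemma D4_a2 : D (D (D (D a2))) = lat (fun m n => nform (m, n) ^+ 4).
Proof. by rewrite D3_a2 D_lat. Qed.

Lemma D_sextic : D sextic = lat (fun m n => nform (m, n) * (m * n * (m + n)) ^+ 2).
Proof. by rewrite D_lat. Qed.

Ltac lattice_ring := apply: eq_lat => m n; rewrite /nform /=; ring.

Lemma moment2E : 3%:R * moment 2 = 2%:R * D a2.
Proof.
rewrite /moment lat_sum3; last by move=> m n; ring.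
rewrite D1_a2 lat_nat; lattice_ring.
Qed.

Lemma moment4E : 3%:R * moment 4 = 2%:R * D (D a2).
Proof.
rewrite /moment lat_sum3; last by move=> m n; ring.
rewrite D2_a2 lat_nat; lattice_ring.
Qed.

Lemma moment6E : 3%:R * moment 6 = 2%:R * D (D (D a2)) + 3%:R * sextic.
Proof.
rewrite /moment lat_sum3; last by move=> m n; ring.
rewrite D3_a2 -lat_lin; lattice_ring.
Qed.

Lemma moment8E : 3%:R * moment 8 = 2%:R * D (D (D (D a2))) + 8%:R * D sextic.
Proof.
rewrite /moment lat_sum3; last by move=> m n; ring.
rewrite D4_a2 D_sextic -lat_lin; lattice_ring.
Qed.

Lemma root_moment2E : 3%:R * root_moment 2 = 6%:R * D a2.
Proof.
rewrite /root_moment lat_sum3; last by move=> m n; ring.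
rewrite D1_a2 lat_nat; lattice_ring.
Qed.

Lemma root_moment4E : 3%:R * root_moment 4 = 18%:R * D (D a2).
Proof.
rewrite /root_moment lat_sum3; last by move=> m n; ring.
rewrite D2_a2 lat_nat; lattice_ring.
Qed.

Lemma root_moment6E : 1%:R * (3%:R * root_moment 6) + 81%:R * sextic = 66%:R * D (D (D a2)).
Proof.
rewrite /root_moment lat_sum3; last by move=> m n; ring.
rewrite D3_a2 -lat_lin lat_nat; lattice_ring.
Qed.

Lemma root_moment8E : 1%:R * (3%:R * root_moment 8) + 648%:R * D sextic = 258%:R * D (D (D (D a2))).
Proof.
rewrite /root_moment lat_sum3; last by move=> m n; ring.
rewrite D4_a2 D_sextic -lat_lin lat_nat; lattice_ring.
Qed.

(** * Heat equations and Taylor coefficients at z = 1 *)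

Lemma qsum_natl (I : choiceType) (e c : I -> int) (x : nat) :
  x%:R * qsum e c = qsum e (fun i => x%:Z * c i).
Proof. by rewrite qsumZ. Qed.

(** The exponent satisfies [8 tri k + 1 = (2k+1)^2]. *)
Lemma mu_heat j : 8%:R * D (mu j) + mu j = mu j.+2.
Proof.
rewrite /mu /half_theta D_qsum qsum_natl -(qsumD (summable_triN _) (summable_triN _)).
apply: eq_qsum => // k; transitivity ((4 * (2 * tri k) + 1) * (altsgn k * (2 * k%:Z + 1) ^+ j)).
  by ring.
by rewrite tri2 !exprS; ring.
Qed.

(** The exponent satisfies [24 pent l + 1 = (6l+1)^2]. *)
Lemma nu_heat j : 24%:R * D (nu j) + nu j = nu j.+2.
Proof.
rewrite /nu /penta D_qsum qsum_natl -(qsumD (summable_pent _) (summable_pent _)).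
apply: eq_qsum => // k; rewrite /pent.
transitivity ((24 * k ^+ 2 + 12 * (2 * tri k) + 1) * (altsgn k * (6 * k + 1) ^+ j)).
  by ring.
by rewrite tri2 !exprS; ring.
Qed.

Lemma theta_pow i : theta (fun x => x ^+ i) = if odd i then 2%:R * mu i else 0.
Proof.
case: ifP => oi; first by rewrite theta_odd // => x; rewrite exprNn -signr_odd oi expr1 mulN1r.
by rewrite theta_even // => x; rewrite exprNn -signr_odd oi expr0 mul1r.
Qed.

Lemma lat_theta_mu (p : nat) : odd p ->
  \sum_(0 <= i < p.+1) (if odd i then 'C(p, i)%:R * ((2 ^ (p - i))%:R * root_moment (p - i) * mu i) else 0)
  = nu 0 * nu 0 * nu p.
Proof.
move=> op; apply: (@fps_natI 1); rewrite -[RHS]lat_theta_pow // mulr_sumr big_mkord.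
apply: eq_bigr => i _; rewrite theta_pow; case: ifP => _; last by rewrite !mulr0.
have -> : lat (fun m n => (2 * (m - n)) ^+ (p - i)) = (2 ^ (p - i))%:R * root_moment (p - i).
  by rewrite lat_nat; apply: eq_lat => m n; rewrite exprMn -[Posz (2 ^ _)%N]natz natrX.
ring.
Qed.

Ltac expand_sum E := rewrite /index_iota /= !big_cons big_nil /= ?add0r ?addr0 in E.

Lemma lat_theta1 : a2 * mu 1 = nu 0 * nu 0 * nu 1.
Proof.
by have E := lat_theta_mu (isT : odd 1); expand_sum E; rewrite !mul1r in E.
Qed.

Lemma lat_theta3 :
  3%:R * (4%:R * root_moment 2 * mu 1) + 1%:R * (1%:R * a2 * mu 3) = nu 0 * nu 0 * nu 3.
Proof. by have E := lat_theta_mu (isT : odd 3); expand_sum E; exact: E. Qed.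

Lemma lat_theta5 :
  5%:R * (16%:R * root_moment 4 * mu 1) + (10%:R * (4%:R * root_moment 2 * mu 3)
  + 1%:R * (1%:R * a2 * mu 5)) = nu 0 * nu 0 * nu 5.
Proof. by have E := lat_theta_mu (isT : odd 5); expand_sum E; exact: E. Qed.

Lemma lat_theta7 :
  7%:R * (64%:R * root_moment 6 * mu 1) + (35%:R * (16%:R * root_moment 4 * mu 3)
  + (21%:R * (4%:R * root_moment 2 * mu 5) + 1%:R * (1%:R * a2 * mu 7))) = nu 0 * nu 0 * nu 7.
Proof. by have E := lat_theta_mu (isT : odd 7); expand_sum E; exact: E. Qed.

Lemma lat_theta9 :
  9%:R * (256%:R * root_moment 8 * mu 1) + (84%:R * (64%:R * root_moment 6 * mu 3)
  + (126%:R * (16%:R * root_moment 4 * mu 5) + (36%:R * (4%:R * root_moment 2 * mu 7)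
  + 1%:R * (1%:R * a2 * mu 9)))) = nu 0 * nu 0 * nu 9.
Proof. by have E := lat_theta_mu (isT : odd 9); expand_sum E; exact: E. Qed.

Lemma theta_div_mu (r : nat) : ~~ odd r ->
  \sum_(0 <= i < r.+1) (if odd i then 'C(r, i)%:R * (2%:R * mu (r - i) * ((2 ^ i)%:R * sigma_gf i)) else 0)
  = half_theta (fun k => \sum_(i < k) (2 * i%:Z + 1) ^+ r - k%:Z * (2 * k%:Z + 1) ^+ r).
Proof.
move=> er; rewrite -theta_div_pow // big_mkord; apply: eq_bigr => i _.
rewrite theta_pow oddB; last by rewrite -ltnS.
rewrite (negPf er) /=; case: ifP => _; last by rewrite mul0r mulr0.
congr (_ * (_ * _)); rewrite /sigma_gf /divsum qsum_natl; apply: eq_qsum => // p.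
by rewrite exprMn -[Posz (2 ^ _)%N]natz natrX.
Qed.

Lemma half_thetaZ (x : int) f : x%:~R * half_theta f = half_theta (fun k => x * f k).
Proof. by rewrite /half_theta -qsumZ; apply: eq_qsum => // k; ring. Qed.

Lemma eq_half_theta f g : f =1 g -> half_theta f = half_theta g.
Proof. by move=> fg; apply: eq_qsum => // k; rewrite fg. Qed.

Definition faul (r k : nat) : int :=
  \sum_(i < k) (2 * i%:Z + 1) ^+ r - k%:Z * (2 * k%:Z + 1) ^+ r.

Lemma faul0 r : faul r 0 = 0.
Proof. by rewrite /faul big_ord0 mul0r subr0. Qed.

Lemma faulS r k : faul r k.+1 =
  faul r k + (k%:Z + 1) * ((2 * k%:Z + 1) ^+ r - (2 * (k%:Z + 1) + 1) ^+ r).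
Proof. by rewrite /faul big_ord_recr /= -[k.+1]addn1 PoszD; ring. Qed.

(** A closed form is verified by its value at 0 and its differences; [x] clears its denominators. *)
Lemma faul_eq r x (f : nat -> int) : f 0 = 0 ->
  (forall k, f k.+1 = f k + x * ((k%:Z + 1) *
                      ((2 * k%:Z + 1) ^+ r - (2 * (k%:Z + 1) + 1) ^+ r))) ->
  forall k, x * faul r k = f k.
Proof.
by move=> f0 fS; elim=> [|k IH]; rewrite ?faul0 ?mulr0 // faulS mulrDr IH fS.
Qed.

Lemma mu_sum (s : seq (int * nat)) :
  \sum_(p <- s) p.1%:~R * mu p.2 = half_theta (fun k => \sum_(p <- s) p.1 * (2 * k%:Z + 1) ^+ p.2).
Proof.
rewrite /half_theta (@eq_qsum _ _ _ (fun k : nat => tri k%:Z)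
  (fun k : nat => \sum_(p <- s) altsgn k%:Z * (p.1 * (2 * k%:Z + 1) ^+ p.2))) // => [|k];
  last by rewrite mulr_sumr.
rewrite qsum_sum => [|p]; last exact: summable_triN.
by apply: eq_bigr => p _; rewrite half_thetaZ /half_theta.
Qed.

Ltac faulhaber r c E :=
  transitivity (c%:~R * half_theta (faul r)); [exact: congr1 E|];
  rewrite mu_sum half_thetaZ; apply/eq_half_theta/faul_eq => *; rewrite ?intS !big_cons !big_nil /=; ring.

(** The list encodes a closed form in [x = 2k+1], here [3 * faul 2 k = x - x^3]. The next lemmas use
    the factors 15, 21 and 45 in the same way. *)
Lemma theta_div2 :
  3%:~R * (2%:R * (2%:R * mu 1 * (2%:R * sigma_gf 1)))
  = \sum_(p <- [:: (1, 1%N); (-1, 3%N)]) p.1%:~R * mu p.2.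
Proof.
by have E := theta_div_mu (isT : ~~ odd 2); expand_sum E; faulhaber 2%N (3 : int) E.
Qed.

Lemma theta_div4 :
  15%:~R * (4%:R * (2%:R * mu 3 * (2%:R * sigma_gf 1)) + 4%:R * (2%:R * mu 1 * (8%:R * sigma_gf 3)))
  = \sum_(p <- [:: (-4, 1%N); (10, 3%N); (-6, 5%N)]) p.1%:~R * mu p.2.
Proof.
by have E := theta_div_mu (isT : ~~ odd 4); expand_sum E; faulhaber 4%N (15 : int) E.
Qed.

Lemma theta_div6 :
  21%:~R * (6%:R * (2%:R * mu 5 * (2%:R * sigma_gf 1)) + (20%:R * (2%:R * mu 3 * (8%:R * sigma_gf 3))
    + 6%:R * (2%:R * mu 1 * (32%:R * sigma_gf 5))))
  = \sum_(p <- [:: (16, 1%N); (-28, 3%N); (21, 5%N); (-9, 7%N)]) p.1%:~R * mu p.2.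
Proof.
by have E := theta_div_mu (isT : ~~ odd 6); expand_sum E; faulhaber 6%N (21 : int) E.
Qed.

Lemma theta_div8 :
  45%:~R * (8%:R * (2%:R * mu 7 * (2%:R * sigma_gf 1)) + (56%:R * (2%:R * mu 5 * (8%:R * sigma_gf 3))
    + (56%:R * (2%:R * mu 3 * (32%:R * sigma_gf 5)) + 8%:R * (2%:R * mu 1 * (128%:R * sigma_gf 7)))))
  = \sum_(p <- [:: (-192, 1%N); (320, 3%N); (-168, 5%N); (60, 7%N); (-20, 9%N)]) p.1%:~R * mu p.2.
Proof.
by have E := theta_div_mu (isT : ~~ odd 8); expand_sum E; faulhaber 8%N (45 : int) E.
Qed.

Lemma mu_0 j : mu j 0 = 1.
Proof.
rewrite /mu /half_theta (qsum_seq (r := [:: 0])) // => [|k _ Ek]; last first.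
  by rewrite inE; have := tri2 k%:Z; nia.
by rewrite big_seq1 eqxx expr1n.
Qed.

Lemma nu_0 j : nu j 0 = 1.
Proof.
rewrite /nu /penta (qsum_seq (r := [:: 0])) // => [|k _ Ek]; last first.
  by rewrite inE; have := tri_ge0 k; move: Ek; rewrite /pent; nia.
by rewrite big_seq1 eqxx expr1n.
Qed.

Lemma a2_0 : a2 0 = 1.
Proof.
rewrite /a2 /lat (qsum_seq (r := [:: (0, 0)])) // => [|[m n] _ Ek].
  by rewrite big_seq1 eqxx.
rewrite inE xpair_eqE; move: Ek; rewrite /nform /= => Ek.
have h : m ^+ 2 + m * n + n ^+ 2 <= 0%N%:Z by lia.
have h' : n ^+ 2 + n * m + m ^+ 2 <= 0%N%:Z by lia.
by have := form_bound h; have := form_bound h'; lia.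
Qed.

Lemma coeff_sigma_gf i n : (0 < n)%N -> sigma_gf i n = (sigma i n)%:Z.
Proof.
move=> n0; rewrite /sigma_gf /divsum (qsum_seq (r := [seq ((n %/ d).-1, d.-1) | d <- divisors n])).
- rewrite /sigma -natz raddf_sum /= big_map [LHS]big_seq [RHS]big_seq; apply: eq_bigr => d.
  rewrite -dvdn_divisors // => dn; have d0 := dvdn_gt0 n0 dn.
  have nd0 : (0 < n %/ d)%N by rewrite divn_gt0 // dvdn_leq.
  by rewrite /= !prednK // divnK // natz eqxx -[RHS]natz natrX natz.
- rewrite map_inj_in_uniq ?divisors_uniq // => d d'.
  rewrite -!dvdn_divisors // => /(dvdn_gt0 n0) ? /(dvdn_gt0 n0) ? [_]; lia.
- move=> [x y] _ /= [E]; apply/mapP; exists y.+1.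
    by rewrite -dvdn_divisors // -E dvdn_mull.
  by rewrite -E mulnK.
Qed.

Lemma sigma_gf_0 i : sigma_gf i 0 = 0.
Proof. by rewrite /sigma_gf /divsum (qsum_seq (r := [::])) ?big_nil. Qed.

(** * Eisenstein series *)

(* Locked, so that rewriting with the rules for D does not look inside. *)
Definition E2 : fps := locked (1 - 24%:R * sigma_gf 1).
Definition E4 : fps := locked (1 + 240%:R * sigma_gf 3).
Definition E6 : fps := locked (1 - 504%:R * sigma_gf 5).
Definition E8 : fps := locked (1 + 480%:R * sigma_gf 7).

Lemma E2E : E2 = 1 - 24%:R * sigma_gf 1. Proof. by rewrite /E2 -lock. Qed.
Lemma E4E : E4 = 1 + 240%:R * sigma_gf 3. Proof. by rewrite /E4 -lock. Qed.
Lemma E6E : E6 = 1 - 504%:R * sigma_gf 5. Proof. by rewrite /E6 -lock. Qed.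
Lemma E8E : E8 = 1 + 480%:R * sigma_gf 7. Proof. by rewrite /E8 -lock. Qed.

(** With the heat equation this says that [E2 - 1] is 8 times the logarithmic derivative of
    [mu 1]. *)
Lemma mu3E : mu 3 = mu 1 * E2.
Proof.
have := theta_div2; rewrite !big_cons big_nil /= => E.
have -> : mu 3 = mu 1 - (1%:~R * mu 1 + ((-1)%:~R * mu 3 + 0)) by ring.
by rewrite -E E2E; ring.
Qed.

(** After division by [mu 1], the heat equation becomes the operator [z -> 8 D z + E2 z]. *)
Lemma mu_step j z : mu j = mu 1 * z -> mu j.+2 = mu 1 * (8%:R * D z + E2 * z).
Proof.
move=> jz; rewrite -mu_heat jz DM.
have : 8%:R * D (mu 1) + mu 1 = mu 1 * E2 by rewrite mu_heat mu3E.
move: E2 (mu 1) (D (mu 1)) (D z) => P m m1 z1 E.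
have -> : 8%:R * (m1 * z + m * z1) + m * z = (8%:R * m1 + m) * z + m * (8%:R * z1) by ring.
by rewrite E; ring.
Qed.

Lemma mu5E : mu 5 = mu 1 * (8%:R * D E2 + E2 ^+ 2).
Proof. by rewrite (mu_step mu3E). Qed.

Lemma mu7E : mu 7 = mu 1 * (64%:R * D (D E2) + 24%:R * E2 * D E2 + E2 ^+ 3).
Proof.
rewrite (mu_step mu5E) !DE; move: E2 (mu 1) (D E2) (D (D E2)) => P m p1 p2; ring.
Qed.

Lemma mu9E : mu 9 = mu 1 * (512%:R * D (D (D E2)) + 192%:R * D E2 ^+ 2
  + 256%:R * E2 * D (D E2) + 48%:R * E2 ^+ 2 * D E2 + E2 ^+ 4).
Proof.
rewrite (mu_step mu7E) !DE.
move: E2 (mu 1) (D E2) (D (D E2)) (D (D (D E2))) => P m p1 p2 p3; ring.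
Qed.

Section LinearCombination.
Variable K : comNzRingType.
Implicit Types x y l r k : K.

Lemma linM k l r : l = r -> k * l = k * r. Proof. by move=> ->. Qed.

Lemma linD l r l' r' : l = r -> l' = r' -> l + l' = r + r'.
Proof. by move=> -> ->. Qed.

(** This checks certificates: known equations are combined with explicit multipliers into [l = r],
    and [ring] confirms that the difference is that of the goal. *)
Lemma lin_eq l r x y : l = r -> x - y = l - r -> x = y.
Proof. by move=> -> /eqP; rewrite subrr subr_eq0 => /eqP. Qed.

End LinearCombination.

Ltac cancel_mu1 := apply: (@fps_mulI (mu 1)); first by rewrite mu_0.

(** The coefficient of order 4 of the logarithmic derivative, divided by [mu 1]. *)
Lemma ramanujan1 : 12%:R * D E2 = E2 ^+ 2 - E4.
Proof.
cancel_mu1; apply: (@fps_natI 3); have := theta_div4.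
rewrite !big_cons big_nil /= mu3E mu5E; move: (D E2) (mu 1) => p1 m E.
by apply: (lin_eq E); rewrite E2E E4E; ring.
Qed.


Lemma ramanujan2 : 3%:R * D E4 = E2 * E4 - E6.
Proof.
have Q : E4 = E2 ^+ 2 - 12%:R * D E2 by rewrite ramanujan1; ring.
(* The order 6 relation still contains [sigma_gf 3], which the first equation eliminates. *)
have S3 : 240%:R * sigma_gf 3 = E2 ^+ 2 - 12%:R * D E2 - 1 by rewrite -Q E4E; ring.
cancel_mu1; have := theta_div6; rewrite !big_cons big_nil /= mu3E mu5E mu7E Q !DE => E.
apply: (@fps_natI 15); move: (D E2) (D (D E2)) (mu 1) S3 E => p1 p2 m S3 E.
apply: (lin_eq (linD (linM (-1) E) (linM (28%:R * m * E2) S3))); rewrite E2E E6E; ring.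
Qed.

(** Order 8 gives one relation for two unknowns, [E8] and [D E6]; the value of [D E6] has to come
    from the lattice. *)
Lemma eisenstein8 : 27%:R * E8 + 40%:R * D E6 = 20%:R * E2 * E6 + 7%:R * E4 ^+ 2.
Proof.
have Q : E4 = E2 ^+ 2 - 12%:R * D E2 by rewrite ramanujan1; ring.
have R : E6 = E2 ^+ 3 - 18%:R * E2 * D E2 + 36%:R * D (D E2).
  by apply: (lin_eq ramanujan2); rewrite Q !DE; ring.
have S3 : 240%:R * sigma_gf 3 = E2 ^+ 2 - 12%:R * D E2 - 1 by rewrite -Q E4E; ring.
have S5 : 504%:R * sigma_gf 5 = 1 - (E2 ^+ 3 - 18%:R * E2 * D E2 + 36%:R * D (D E2)).
  by rewrite -R E6E; ring.
cancel_mu1; have := theta_div8; rewrite !big_cons big_nil /= mu3E mu5E mu7E mu9E Q R !DE => E.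
apply: (@fps_natI 63).
move: (D E2) (D (D E2)) (D (D (D E2))) (mu 1) S3 S5 E => p1 p2 p3 m S3 S5 E.
apply: (lin_eq (linD (linM 9%:R E) (linD (linM (- 1512%:R * m * (8%:R * p1 + E2 ^+ 2)) S3)
  (linM (- 2880%:R * m * E2) S5)))).
by rewrite E2E E8E; ring.
Qed.

(** * The equation of a2, the sextic moment and Chazy's equation *)

Lemma root_moment2D : root_moment 2 = 2%:R * D a2.
Proof. by apply: (@fps_natI 2); apply: (lin_eq root_moment2E); ring. Qed.

Lemma root_moment4D : root_moment 4 = 6%:R * D (D a2).
Proof. by apply: (@fps_natI 2); apply: (lin_eq root_moment4E); ring. Qed.

Lemma root_moment6D : root_moment 6 = 22%:R * D (D (D a2)) - 27%:R * sextic.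
Proof. by apply: (@fps_natI 2); apply: (lin_eq root_moment6E); ring. Qed.

Lemma root_moment8D : root_moment 8 = 86%:R * D (D (D (D a2))) - 216%:R * D sextic.
Proof. by apply: (@fps_natI 2); apply: (lin_eq root_moment8E); ring. Qed.

(* The logarithmic derivative of Jacobi's identity [mu 1 = nu 0 ^+ 3]. *)
Lemma D_nu0 : 24%:R * D (nu 0) = nu 0 * (E2 - 1).
Proof.
have Z0 := lat_theta1; have Z1 := congr1 D Z0; rewrite !DM in Z1.
have Z3 := lat_theta3; rewrite root_moment2D -(nu_heat 1) mu3E in Z3.
have Zm := mu_heat 1; rewrite mu3E in Zm.
apply: (@fps_mulI (2%:R * nu 0 * nu 1)); first by rewrite !fpsE0 !nu_0.
move: E2 a2 (mu 1) (nu 0) (nu 1) (D a2) (D (mu 1)) (D (nu 0)) (D (nu 1)) Z0 Z1 Z3 Zm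
  => P a m F n a1 m1 F1 n1 Z0 Z1 Z3 Zm.
apply: (lin_eq (linD (linM (- 24%:R) Z1) (linD Z3 (linD (linM (3%:R * a) Zm)
  (linM (2%:R * P - 3%:R) Z0))))); ring.
Qed.

(** The heat equation of [nu j], combined with the logarithmic derivatives of [nu 0] and [mu 1]. *)
Lemma nu_step j b : nu 0 * nu 0 * nu j = mu 1 * b ->
  nu 0 * nu 0 * nu j.+2 = mu 1 * (24%:R * D b + E2 * b).
Proof.
move=> Z0; have Z1 := congr1 D Z0; rewrite !DM in Z1.
have ZF := D_nu0; have Zm := mu_heat 1; rewrite mu3E in Zm.
rewrite -nu_heat.
move: E2 (mu 1) (nu 0) (nu j) (D b) (D (mu 1)) (D (nu 0)) (D (nu j)) Z0 Z1 ZF Zm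
  => P m F n b1 m1 F1 n1 Z0 Z1 ZF Zm.
apply: (lin_eq (linD (linM 24%:R Z1) (linD (linM (- 2%:R * F * n) ZF) (linD (linM (3%:R * b) Zm)
  (linM (3%:R - 2%:R * P) Z0))))); ring.
Qed.

Lemma nu3E : nu 0 * nu 0 * nu 3 = mu 1 * (24%:R * D a2 + E2 * a2).
Proof. by apply: nu_step; rewrite -lat_theta1 mulrC. Qed.

Lemma nu5E : nu 0 * nu 0 * nu 5 = mu 1 * (576%:R * D (D a2) + 48%:R * E2 * D a2
  + (24%:R * D E2 + E2 ^+ 2) * a2).
Proof.
rewrite (nu_step nu3E) !DE.
move: (D (D a2)) (D a2) a2 (D E2) (mu 1) => d2 d1 d0 p1 m; ring.
Qed.

Lemma nu7E : nu 0 * nu 0 * nu 7 = mu 1 * (13824%:R * D (D (D a2)) + 1728%:R * E2 * D (D a2)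
  + (1728%:R * D E2 + 72%:R * E2 ^+ 2) * D a2
  + (576%:R * D (D E2) + 72%:R * E2 * D E2 + E2 ^+ 3) * a2).
Proof.
rewrite (nu_step nu5E) !DE.
move: (D (D (D a2))) (D (D a2)) (D a2) a2 (D (D E2)) (D E2) (mu 1) => d3 d2 d1 d0 p2 p1 m; ring.
Qed.

Lemma nu9E : nu 0 * nu 0 * nu 9 = mu 1 * (331776%:R * D (D (D (D a2)))
  + 55296%:R * E2 * D (D (D a2)) + (82944%:R * D E2 + 3456%:R * E2 ^+ 2) * D (D a2)
  + (55296%:R * D (D E2) + 6912%:R * E2 * D E2 + 96%:R * E2 ^+ 3) * D a2
  + (13824%:R * D (D (D E2)) + 1728%:R * D E2 ^+ 2 + 2304%:R * E2 * D (D E2)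
     + 144%:R * E2 ^+ 2 * D E2 + E2 ^+ 4) * a2).
Proof.
rewrite (nu_step nu7E) !DE.
move: (D (D (D (D a2)))) (D (D (D a2))) (D (D a2)) (D a2) a2 (D (D (D E2))) (D (D E2)) (D E2)
  (mu 1) => d4 d3 d2 d1 d0 p3 p2 p1 m; ring.
Qed.

(** The lattice identity of order 5 divided by [mu 1]; orders 1 and 3 already gave the derivative of
    [nu 0]. *)
Lemma a2_ode : 6%:R * D (D a2) = 2%:R * E2 * D a2 - D E2 * a2.
Proof.
apply: (@fps_natI 15); cancel_mu1.
have := lat_theta5; rewrite nu5E mu3E mu5E root_moment4D root_moment2D.
move: (D (D a2)) (D a2) a2 (D E2) (mu 1) => d2 d1 d0 p1 m E.
by apply: (lin_eq (linM (-1) E)); ring.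
Qed.

(** Order 7 is the first to involve the sextic moment, and it determines that moment. *)
Lemma sexticE : 756%:R * sextic = 102%:R * E2 * D (D a2) - 248%:R * D (D (D a2))
  + (6%:R * E2 ^+ 2 - 24%:R * D E2) * D a2
  - (32%:R * D (D E2) + 3%:R * E2 * D E2) * a2.
Proof.
apply: (@fps_natI 15); cancel_mu1.
have := lat_theta7; rewrite nu7E mu3E mu5E mu7E root_moment6D root_moment4D root_moment2D.
move: (D (D (D a2))) (D (D a2)) (D a2) a2 (D (D E2)) (D E2) (mu 1) sextic => d3 d2 d1 d0 p2 p1 m e E.
by apply: (lin_eq (linM (-1) E)); ring.
Qed.

(** In order 9, [a2_ode] with its two derivatives and [sexticE] with its derivative eliminate the
    lattice terms. What remains is [9856 * a2] times an equation in [E2] alone. *)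
Lemma chazy : 2%:R * D (D (D E2)) + 3%:R * D E2 ^+ 2 = 2%:R * E2 * D (D E2).
Proof.
have Z2 := a2_ode; have Z3 := congr1 D Z2; rewrite !DE in Z3.
have Z4 := congr1 D Z3; rewrite !DE in Z4.
have Ze := sexticE; have Ze1 := congr1 D Ze; rewrite !DE in Ze1.
apply: (@fps_mulI (9856%:R * a2)); first by rewrite !fpsE0 a2_0.
cancel_mu1; have := lat_theta9; rewrite nu9E mu3E mu5E mu7E mu9E root_moment8D root_moment6D root_moment4D root_moment2D.
move: (D (D (D (D a2)))) (D (D (D a2))) (D (D a2)) (D a2) a2 (D (D (D E2))) (D (D E2)) (D E2)
  (mu 1) (D sextic) sextic Z2 Z3 Z4 Ze Ze1 => d4 d3 d2 d1 d0 p3 p2 p1 m e1 e Z2 Z3 Z4 Ze Ze1 E9.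
apply: (lin_eq (linD (linM 7%:R E9) (linM m (linD (linM 4608%:R Ze1) (linD (linM (1344%:R * E2) Ze)
  (linD (linM (- 34560%:R) Z4) (linD (linM (- (62208%:R * E2)) Z3)
  (linM (26496%:R * p1 - 3360%:R * E2 ^+ 2) Z2)))))))); ring.
Qed.

(** Chazy's equation, rewritten by expressing [E4] and [E6] through [E2] and its derivatives. *)
Lemma ramanujan3 : 2%:R * D E6 = E2 * E6 - E4 ^+ 2.
Proof.
have Q : E4 = E2 ^+ 2 - 12%:R * D E2 by apply: (lin_eq ramanujan1); ring.
have R : E6 = E2 ^+ 3 - 18%:R * E2 * D E2 + 36%:R * D (D E2).
  by apply: (lin_eq ramanujan2); rewrite Q !DE; ring.
have := chazy; rewrite R Q !DE.
move: (D (D (D E2))) (D (D E2)) (D E2) => p3 p2 p1 C.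
by apply: (lin_eq (linM 36%:R C)); ring.
Qed.

Lemma E8_sqr : E8 = E4 ^+ 2.
Proof.
apply: (@fps_natI 26); apply: (lin_eq (linD eisenstein8 (linM (- 20%:R) ramanujan3))); ring.
Qed.

(* The two defects satisfy a linear differential system without constant terms, whose
   indicial roots at q = 0 are 0 and 1/3; hence both vanish. *)
Definition defectA : fps :=
  locked (E4 + 2%:R * a2 ^+ 2 * E2 - 3%:R * a2 ^+ 4 - 24%:R * a2 * D a2).
Definition defectB : fps :=
  locked (27%:R * a2 ^+ 8 - 18%:R * E4 * a2 ^+ 4 - 8%:R * E6 * a2 ^+ 2 - E4 ^+ 2).

Lemma D_defectA : a2 ^+ 2 * (24%:R * D defectA) = defectB
  + (4%:R * a2 ^+ 2 * E2 + 12%:R * a2 ^+ 4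
     + 2%:R * (E4 + 2%:R * a2 ^+ 2 * E2 - 3%:R * a2 ^+ 4) - defectA) * defectA.
Proof.
have Z2 := a2_ode; have R1 := ramanujan1; have R2 := ramanujan2.
rewrite /defectA /defectB -!lock !DE.
move: (D (D a2)) (D a2) a2 (D E4) (D E2) E6 Z2 R1 R2 => d2 d1 d0 q1 p1 R Z2 R1 R2.
apply: (lin_eq (linD (linM (- 96%:R * d0 ^+ 3) Z2) (linD (linM (12%:R * d0 ^+ 4) R1)
  (linM (8%:R * d0 ^+ 2) R2)))); ring.
Qed.

Lemma D_defectB : 3%:R * D defectB = (2%:R * E2 - 3%:R * a2 ^+ 2) * defectB
  + (2%:R * E6 + 9%:R * E4 * a2 ^+ 2 - 27%:R * a2 ^+ 6) * defectA.
Proof.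
have R2 := ramanujan2; have R3 := ramanujan3; rewrite /defectA /defectB -!lock !DE.
move: (D a2) a2 (D E6) (D E4) E6 R2 R3 => d1 d0 r1 q1 R R2 R3.
apply: (lin_eq (linD (linM (- (18%:R * d0 ^+ 4 + 2%:R * E4)) R2)
  (linM (- 12%:R * d0 ^+ 2) R3))); ring.
Qed.

Lemma E2_0 : E2 0 = 1. Proof. by rewrite E2E !fpsE0 sigma_gf_0. Qed.
Lemma E4_0 : E4 0 = 1. Proof. by rewrite E4E !fpsE0 sigma_gf_0. Qed.
Lemma E6_0 : E6 0 = 1. Proof. by rewrite E6E !fpsE0 sigma_gf_0. Qed.

Lemma defect0 n : defectA n = 0 /\ defectB n = 0.
Proof.
have A0 : defectA 0 = 0 by rewrite /defectA -lock !fpsE0 coeff_D a2_0 E2_0 E4_0.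
elim/ltn_ind: n => -[_|n IH]; first by rewrite A0 /defectB -lock !fpsE0 a2_0 E4_0 E6_0.
have Alt i : (i < n.+1)%N -> defectA i = 0 by move=> /IH[].
have Blt i : (i < n.+1)%N -> defectB i = 0 by move=> /IH[].
have DAlt i : (i < n.+1)%N -> (24%:R * D defectA) i = 0.
  by move=> ltin; rewrite coeffMnat coeff_D Alt ?mulr0.
have := congr1 (fun x : fps => x n.+1) D_defectA.
have := congr1 (fun x : fps => x n.+1) D_defectB.
rewrite !coeffD (coeffM_lead _ DAlt) !(coeffM_lead _ Alt) (coeffM_lead _ Blt) !coeffMnat !coeff_D.
rewrite !fpsE0 A0 a2_0 E2_0 E4_0 E6_0.
(* With [m = n.+1] these read [(24m - 16) A = B] and [(3m + 1) B = -16 A], hence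
   [24m (3m - 1) A = 0]. *)
move: (defectA n.+1) (defectB n.+1) => A B EB EA; nia.
Qed.

Lemma E4_a2 : E4 = 24%:R * a2 * D a2 - 2%:R * a2 ^+ 2 * E2 + 3%:R * a2 ^+ 4.
Proof.
have : defectA = 0 by apply: fpsP => n; rewrite (defect0 n).1.
by rewrite /defectA -lock => E; apply: (lin_eq E); ring.
Qed.

(** * The ring generated by a2, E2 and Y *)

(** The factor 12 makes the derivation map integer polynomials in [a2], [E2] and [Y] to integer
    polynomials. *)
Definition dl (x : fps) : fps := locked (12%:R * D x).

Lemma dl_def x : dl x = 12%:R * D x. Proof. by rewrite /dl -lock. Qed.

Lemma dlM x y : dl (x * y) = dl x * y + x * dl y.
Proof. by rewrite !dl_def DM; ring. Qed.
Lemma dlD x y : dl (x + y) = dl x + dl y.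
Proof. by rewrite !dl_def DD; ring. Qed.
Lemma dlN x : dl (- x) = - dl x.
Proof. by rewrite !dl_def DN; ring. Qed.
Lemma dlnat n : dl n%:R = 0.
Proof. by rewrite dl_def Dnat mulr0. Qed.
Lemma dl0 : dl 0 = 0.
Proof. exact: (dlnat 0). Qed.
Lemma dlX x n : dl (x ^+ n.+1) = n.+1%:R * x ^+ n * dl x.
Proof. by rewrite !dl_def DX; ring. Qed.

(* [4 c^3] in the notation of the Borweins' cubic theta functions [a, b, c]. *)
Definition Y : fps := locked (12%:R * D a2 - a2 * E2 + a2 ^+ 3).

Lemma dl_a2 : dl a2 = a2 * E2 - a2 ^+ 3 + Y.
Proof. by rewrite dl_def /Y -lock; ring. Qed.

Lemma E4_Y : E4 = a2 ^+ 4 + 2%:R * a2 * Y.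
Proof. by rewrite E4_a2 /Y -lock; ring. Qed.

Lemma dl_E2 : dl E2 = E2 ^+ 2 - a2 ^+ 4 - 2%:R * a2 * Y.
Proof. by rewrite dl_def ramanujan1 E4_Y; ring. Qed.

Lemma dl_Y : dl Y = 3%:R * Y * (E2 + 3%:R * a2 ^+ 2).
Proof.
have := dl_a2; have := dl_E2; rewrite !dl_def => p1 d1; have Z2 := a2_ode.
rewrite /Y -lock !DE.
move: (D (D a2)) (D a2) (D E2) d1 p1 Z2 => A2 A1 P1 d1 p1 Z2.
have dY : Y = 12%:R * A1 - a2 * E2 + a2 ^+ 3 by rewrite d1; ring.
rewrite -dY; apply: (lin_eq (linD (linM 24%:R Z2) (linD (linM (3%:R * E2 + 3%:R * a2 ^+ 2) d1) (linM (- 3%:R * a2) p1)))).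
ring.
Qed.

Definition dlE := (dlnat, dlM, dlD, dlN, dl0, dlX, dl_a2, dl_E2, dl_Y).

(** The second Ramanujan equation solved for [E6]. *)
Lemma E6_Y : 2%:R * E6 = 2%:R * a2 ^+ 6 - 10%:R * a2 ^+ 3 * Y - Y ^+ 2.
Proof.
have E : dl E4 = 4%:R * (E2 * E4 - E6).
  by rewrite dl_def -ramanujan2; ring.
rewrite E4_Y !dlE in E.
by apply: (@fps_natI 1); apply: (lin_eq E); ring.
Qed.

(** Series known only up to an integer factor [c] are differentiated in the ring; each derivative
    multiplies the factor by 12. *)
Lemma dl_scale c' c x y : c%:R * x = y -> (12 * c = c')%N -> c'%:R * D x = dl y.
Proof. by move=> <- <-; rewrite dl_def DM Dnat natrM; ring. Qed.

Ltac dl_scale E := apply: etrans (dl_scale E _) _; [by []|rewrite !dlE; ring].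

(** * Derivatives and moments as polynomials in a2, E2 and Y *)

Lemma D1_a2Y : 12%:R * D a2 = a2 * E2 - a2 ^+ 3 + Y.
Proof. by rewrite -dl_def dl_a2. Qed.

Lemma D2_a2Y : 144%:R * D (D a2) = 4%:R * E2 * Y - 4%:R * E2 * a2 ^+ 3
  + 2%:R * E2 ^+ 2 * a2 + 4%:R * Y * a2 ^+ 2 + 2%:R * a2 ^+ 5.
Proof. dl_scale D1_a2Y. Qed.

Lemma D3_a2Y : 1728%:R * D (D (D a2)) = 36%:R * E2 * Y * a2 ^+ 2 + 18%:R * E2 * a2 ^+ 5
  + 18%:R * E2 ^+ 2 * Y - 18%:R * E2 ^+ 2 * a2 ^+ 3 + 6%:R * E2 ^+ 3 * a2
  + 42%:R * Y * a2 ^+ 4 - 6%:R * a2 ^+ 7.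
Proof. dl_scale D2_a2Y. Qed.

Lemma D4_a2Y : 20736%:R * D (D (D (D a2))) = 672%:R * E2 * Y * a2 ^+ 4 - 96%:R * E2 * a2 ^+ 7
  + 288%:R * E2 ^+ 2 * Y * a2 ^+ 2 + 144%:R * E2 ^+ 2 * a2 ^+ 5 + 96%:R * E2 ^+ 3 * Y
  - 96%:R * E2 ^+ 3 * a2 ^+ 3 + 24%:R * E2 ^+ 4 * a2 + 96%:R * Y * a2 ^+ 6
  + 96%:R * Y ^+ 2 * a2 ^+ 3 + 24%:R * a2 ^+ 9.
Proof. dl_scale D3_a2Y. Qed.

Lemma D2_E2Y : 144%:R * D (D E2) = 2%:R * E2 ^+ 3 - 12%:R * E2 * Y * a2 - 6%:R * E2 * a2 ^+ 4
  - 20%:R * Y * a2 ^+ 3 - 2%:R * Y ^+ 2 + 4%:R * a2 ^+ 6.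
Proof. have h := dl_E2; rewrite dl_def in h; dl_scale h. Qed.

Lemma sexticY : 3888%:R * sextic = 6%:R * E2 * Y * a2 ^+ 2 + 3%:R * E2 * a2 ^+ 5
  + 3%:R * E2 ^+ 2 * Y - 3%:R * E2 ^+ 2 * a2 ^+ 3 + E2 ^+ 3 * a2 - 9%:R * Y * a2 ^+ 4
  + 4%:R * Y ^+ 2 * a2 - a2 ^+ 7.
Proof.
have h0 := sexticE; have h1 := D1_a2Y; have h2 := D2_a2Y; have h3 := D3_a2Y.
have := dl_E2; rewrite dl_def => g1; have g2 := D2_E2Y.
(* Clearing denominators multiplies [sexticE] by 1728, and the common factor 336 is then removed:
   [1728 * 756 = 336 * 3888]. *)
apply: (@fps_natI 335); move: (D (D (D a2))) (D (D a2)) (D a2) (D (D E2)) (D E2) h0 h1 h2 h3 g1 g2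
  => A3 A2 A1 p2 p1 h0 h1 h2 h3 g1 g2.
apply: (lin_eq (linD (linM 1728%:R h0) (linD (linM (1224%:R * E2) h2) (linD (linM (- 248%:R) h3)
  (linD (linM (864%:R * E2 ^+ 2 - 288%:R * (E2 ^+ 2 - a2 ^+ 4 - 2%:R * a2 * Y)) h1)
  (linD (linM (- 288%:R * (12%:R * A1) - 432%:R * E2 * a2) g1) (linM (- 384%:R * a2) g2))))))).
ring.
Qed.

Lemma D_sexticY : 46656%:R * D sextic = 28%:R * E2 * Y ^+ 2 * a2 - 16%:R * E2 * a2 ^+ 7
  + 48%:R * E2 ^+ 2 * Y * a2 ^+ 2 + 24%:R * E2 ^+ 2 * a2 ^+ 5 + 16%:R * E2 ^+ 3 * Y
  - 16%:R * E2 ^+ 3 * a2 ^+ 3 + 4%:R * E2 ^+ 4 * a2 - 64%:R * Y * a2 ^+ 6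
  + 20%:R * Y ^+ 2 * a2 ^+ 3 + 4%:R * Y ^+ 3 + 4%:R * a2 ^+ 9.
Proof. dl_scale sexticY. Qed.

Lemma moment2Y : 18%:R * moment 2 = a2 * E2 - a2 ^+ 3 + Y.
Proof. by apply: (lin_eq (linD (linM 6%:R moment2E) D1_a2Y)); ring. Qed.

Lemma moment4Y : 216%:R * moment 4 = 4%:R * E2 * Y - 4%:R * E2 * a2 ^+ 3
  + 2%:R * E2 ^+ 2 * a2 + 4%:R * Y * a2 ^+ 2 + 2%:R * a2 ^+ 5.
Proof. by apply: (lin_eq (linD (linM 72%:R moment4E) D2_a2Y)); ring. Qed.

Lemma moment6Y : 1944%:R * moment 6 = 30%:R * E2 * Y * a2 ^+ 2 + 15%:R * E2 * a2 ^+ 5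
  + 15%:R * E2 ^+ 2 * Y - 15%:R * E2 ^+ 2 * a2 ^+ 3 + 5%:R * E2 ^+ 3 * a2
  + 27%:R * Y * a2 ^+ 4 + 2%:R * Y ^+ 2 * a2 - 5%:R * a2 ^+ 7.
Proof.
apply: (@fps_natI 3).
by apply: (lin_eq (linD (linM 2592%:R moment6E) (linD (linM 3%:R D3_a2Y) (linM 2%:R sexticY)))); ring.
Qed.

Lemma moment8Y : 34992%:R * moment 8 = 756%:R * E2 * Y * a2 ^+ 4 + 56%:R * E2 * Y ^+ 2 * a2
  - 140%:R * E2 * a2 ^+ 7 + 420%:R * E2 ^+ 2 * Y * a2 ^+ 2 + 210%:R * E2 ^+ 2 * a2 ^+ 5
  + 140%:R * E2 ^+ 3 * Y - 140%:R * E2 ^+ 3 * a2 ^+ 3 + 35%:R * E2 ^+ 4 * a2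
  - 20%:R * Y * a2 ^+ 6 + 148%:R * Y ^+ 2 * a2 ^+ 3 + 8%:R * Y ^+ 3 + 35%:R * a2 ^+ 9.
Proof.
apply: (@fps_natI 7).
by apply: (lin_eq (linD (linM 93312%:R moment8E) (linD (linM 9%:R D4_a2Y) (linM 16%:R D_sexticY)))); ring.
Qed.

(** * The sums L as multiples of one cusp form *)

Lemma mulr_eq (c x y z : fps) : c * x = y -> c * (x * z) = y * z.
Proof. by rewrite mulrA => ->. Qed.

Lemma dl_mulr c' c x y z : c%:R * x = y -> (12 * c = c')%N -> c'%:R * D (x * z) = dl (y * z).
Proof. by move=> xy; apply: dl_scale; rewrite mulrA xy. Qed.

Lemma moment0 : 1%:R * moment 0 = a2. Proof. exact: mul1r. Qed.

(** In the Borweins' notation this is [16 b^3 c^3], which is 432 times the level 3, weight 6 cusp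
    form [eta(t)^6 eta(3t)^6]. *)
Definition cusp6 : fps := Y * (4%:R * a2 ^+ 3 - Y).

(** Multiplication by [n] becomes [D], and each further pair of coordinates contributes a factor
    [a2]. The summands of the [L] are zonal harmonics (Gegenbauer polynomials), so all terms with
    [E2] cancel. *)
Lemma gf6_2 : 36%:R * (9%:R * (moment 4 * a2 ^+ 1) - 9%:R * D (moment 2 * a2 ^+ 1)
  + D (D (moment 0 * a2 ^+ 1))) = cusp6.
Proof.
have h4 := mulr_eq (a2 ^+ 1) moment4Y.
have h2 := @dl_mulr 216 _ _ _ (a2 ^+ 1) moment2Y erefl.
have h0 := @dl_scale 144 _ _ _ (@dl_mulr 12 _ _ _ (a2 ^+ 1) moment0 erefl) erefl.
rewrite !dlE in h2 h0; apply: (@fps_natI 11).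
apply: (lin_eq (linD (linM 18%:R h4) (linD (linM (- 18%:R) h2) (linM 3%:R h0)))).
rewrite /cusp6; ring.
Qed.

Lemma gf8_4 : 4%:R * (45%:R * (moment 4 * a2 ^+ 3) - 30%:R * D (moment 2 * a2 ^+ 3)
  + 2%:R * D (D (moment 0 * a2 ^+ 3))) = cusp6 * a2 ^+ 2.
Proof.
have h4 := mulr_eq (a2 ^+ 3) moment4Y.
have h2 := @dl_mulr 216 _ _ _ (a2 ^+ 3) moment2Y erefl.
have h0 := @dl_scale 144 _ _ _ (@dl_mulr 12 _ _ _ (a2 ^+ 3) moment0 erefl) erefl.
rewrite !dlE in h2 h0; apply: (@fps_natI 53).
apply: (lin_eq (linD (linM 45%:R h4) (linD (linM (- 30%:R) h2) (linM 3%:R h0)))).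
rewrite /cusp6; ring.
Qed.

Lemma gf10_6 : 18%:R * (42%:R * (moment 4 * a2 ^+ 5) - 21%:R * D (moment 2 * a2 ^+ 5)
  + D (D (moment 0 * a2 ^+ 5))) = 5%:R * cusp6 * a2 ^+ 4.
Proof.
have h4 := mulr_eq (a2 ^+ 5) moment4Y.
have h2 := @dl_mulr 216 _ _ _ (a2 ^+ 5) moment2Y erefl.
have h0 := @dl_scale 144 _ _ _ (@dl_mulr 12 _ _ _ (a2 ^+ 5) moment0 erefl) erefl.
rewrite !dlE in h2 h0; apply: (@fps_natI 23).
apply: (lin_eq (linD (linM 84%:R h4) (linD (linM (- 42%:R) h2) (linM 3%:R h0)))).
rewrite /cusp6; ring.
Qed.

Lemma gf14_10 : 4%:R * (99%:R * (moment 4 * a2 ^+ 9) - 33%:R * D (moment 2 * a2 ^+ 9)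
  + D (D (moment 0 * a2 ^+ 9))) = 3%:R * cusp6 * a2 ^+ 8.
Proof.
have h4 := mulr_eq (a2 ^+ 9) moment4Y.
have h2 := @dl_mulr 216 _ _ _ (a2 ^+ 9) moment2Y erefl.
have h0 := @dl_scale 144 _ _ _ (@dl_mulr 12 _ _ _ (a2 ^+ 9) moment0 erefl) erefl.
rewrite !dlE in h2 h0; apply: (@fps_natI 107).
apply: (lin_eq (linD (linM 198%:R h4) (linD (linM (- 66%:R) h2) (linM 3%:R h0)))).
rewrite /cusp6; ring.
Qed.

(** By symmetry the average of [x_1^2] over the solutions of [F_8 = n] is [n/12]. *)
Lemma moment2_pow7 : 12%:R * (moment 2 * a2 ^+ 7) = D (moment 0 * a2 ^+ 7).
Proof.
apply: (lin_eq (linM (4%:R * a2 ^+ 7) moment2E)); rewrite (_ : moment 0 = a2) // DM DX; ring.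
Qed.

Lemma gf14_8 : 72%:R * (594%:R * (moment 6 * a2 ^+ 7) - 495%:R * D (moment 4 * a2 ^+ 7)
  + 90%:R * D (D (moment 2 * a2 ^+ 7)) - 2%:R * D (D (D (moment 0 * a2 ^+ 7))))
  = cusp6 * a2 ^+ 5 * (110%:R * a2 ^+ 3 - 77%:R * Y).
Proof.
have h6 := mulr_eq (a2 ^+ 7) moment6Y.
have h4 := @dl_mulr 2592 _ _ _ (a2 ^+ 7) moment4Y erefl.
(* This trades the second derivative of the quadratic moment for a third derivative of [a2 ^+ 8]. *)
have h2 := congr1 (fun x => D (D x)) moment2_pow7; rewrite !D_natl in h2.
(* Like terms are collected here, before the third differentiation. *)
have h0 : 144%:R * D (D (moment 0 * a2 ^+ 7)) = 144%:R * E2 * Y * a2 ^+ 7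
    - 144%:R * E2 * a2 ^+ 10 + 72%:R * E2 ^+ 2 * a2 ^+ 8 - 80%:R * Y * a2 ^+ 9
    + 56%:R * Y ^+ 2 * a2 ^+ 6 + 72%:R * a2 ^+ 12.
  dl_scale (@dl_mulr 12 _ _ _ (a2 ^+ 7) moment0 erefl).
have {}h0 := @dl_scale 1728 _ _ _ h0 erefl.
rewrite !dlE in h4 h0; apply: (@fps_natI 431).
apply: (lin_eq (linD (linM 9504%:R h6) (linD (linM (- 5940%:R) h4) (linD (linM 233280%:R h2)
  (linM 99%:R h0))))).
rewrite /cusp6; ring.
Qed.

Lemma moment2_pow5 : 9%:R * (moment 2 * a2 ^+ 5) = D (moment 0 * a2 ^+ 5).
Proof.
apply: (lin_eq (linM (3%:R * a2 ^+ 5) moment2E)); rewrite (_ : moment 0 = a2) // DM DX; ring.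
Qed.

Lemma gf14_6 : 144%:R * (8019%:R * (moment 8 * a2 ^+ 5) - 12474%:R * D (moment 6 * a2 ^+ 5)
  + 5670%:R * D (D (moment 4 * a2 ^+ 5)) - 756%:R * D (D (D (moment 2 * a2 ^+ 5)))
  + 14%:R * D (D (D (D (moment 0 * a2 ^+ 5)))))
  = cusp6 * a2 ^+ 2 * (780%:R * a2 ^+ 6 - 40%:R * a2 ^+ 3 * Y + 175%:R * Y ^+ 2).
Proof.
have h8 := mulr_eq (a2 ^+ 5) moment8Y.
have := @dl_mulr 23328 _ _ _ (a2 ^+ 5) moment6Y erefl; rewrite !dlE => h6.
have h4 : 2592%:R * D (moment 4 * a2 ^+ 5) = 16%:R * E2 * Y * a2 ^+ 7
    + 20%:R * E2 * Y ^+ 2 * a2 ^+ 4 + 48%:R * E2 * a2 ^+ 10 + 48%:R * E2 ^+ 2 * Y * a2 ^+ 5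
    - 48%:R * E2 ^+ 2 * a2 ^+ 8 + 16%:R * E2 ^+ 3 * a2 ^+ 6 + 32%:R * Y * a2 ^+ 9
    + 20%:R * Y ^+ 2 * a2 ^+ 6 - 16%:R * a2 ^+ 12.
  dl_scale (mulr_eq (a2 ^+ 5) moment4Y).
have {h4} := @dl_scale 31104 _ _ _ h4 erefl; rewrite !dlE => h4.
have h2 := congr1 (fun x => D (D (D x))) moment2_pow5; rewrite !D_natl in h2.
have h0 : 144%:R * D (D (moment 0 * a2 ^+ 5)) = 84%:R * E2 * Y * a2 ^+ 5 - 84%:R * E2 * a2 ^+ 8
    + 42%:R * E2 ^+ 2 * a2 ^+ 6 - 36%:R * Y * a2 ^+ 7 + 30%:R * Y ^+ 2 * a2 ^+ 4
    + 42%:R * a2 ^+ 10.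
  dl_scale (@dl_mulr 12 _ _ _ (a2 ^+ 5) moment0 erefl).
have {}h0 : 1728%:R * D (D (D (moment 0 * a2 ^+ 5))) = 720%:R * E2 * Y ^+ 2 * a2 ^+ 4
    - 864%:R * E2 * Y * a2 ^+ 7 + 1008%:R * E2 * a2 ^+ 10 + 1008%:R * E2 ^+ 2 * Y * a2 ^+ 5
    - 1008%:R * E2 ^+ 2 * a2 ^+ 8 + 336%:R * E2 ^+ 3 * a2 ^+ 6 + 432%:R * Y * a2 ^+ 9
    + 120%:R * Y ^+ 3 * a2 ^+ 3 - 336%:R * a2 ^+ 12.
  dl_scale h0.
have {h0} := @dl_scale 20736 _ _ _ h0 erefl; rewrite !dlE => h0.
apply: (@fps_natI 3887).
apply: (lin_eq (linD (linM 128304%:R h8) (linD (linM (- 299376%:R) h6)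
  (linD (linM 102060%:R h4) (linD (linM (- 47029248%:R) h2) (linM (- 1890%:R) h0)))))).
rewrite /cusp6; ring.
Qed.

(** All six series have weight 14 and equal [cusp6] times a combination of [a2^8], [a2^5 Y] and
    [a2^2 Y^2]; it remains to compare three coefficients. *)
Lemma cusp_identity (L6 L8 L10 L14 L14' L14'' : fps) :
  36%:R * L6 = cusp6 -> 4%:R * L8 = cusp6 * a2 ^+ 2 -> 18%:R * L10 = 5%:R * cusp6 * a2 ^+ 4 ->
  4%:R * L14 = 3%:R * cusp6 * a2 ^+ 8 ->
  72%:R * L14' = cusp6 * a2 ^+ 5 * (110%:R * a2 ^+ 3 - 77%:R * Y) ->
  144%:R * L14'' = cusp6 * a2 ^+ 2 * (780%:R * a2 ^+ 6 - 40%:R * a2 ^+ 3 * Y + 175%:R * Y ^+ 2) ->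
  5082525%:R * (E8 * L6) + 4253200%:R * (E6 * L8) + 8315055%:R * (E4 * L10)
  = 4251465%:R * L14 + 116640%:R * L14' + 27216%:R * L14''.
Proof.
move=> h6 h8 h10 h14 h14' h14''; rewrite E8_sqr E4_Y; apply: (@fps_natI 143).
apply: (lin_eq (linD (linM (20330100%:R * (a2 ^+ 4 + 2%:R * a2 * Y) ^+ 2) h6)
  (linD (linM (153115200%:R * E6) h8)
  (linD (linM (66520440%:R * (a2 ^+ 4 + 2%:R * a2 * Y)) h10)
  (linD (linM (- 153052740%:R) h14)
  (linD (linM (- 233280%:R) h14') (linD (linM (- 27216%:R) h14'')
  (linM (76557600%:R * cusp6 * a2 ^+ 2) E6_Y)))))))).
ring.
Qed.

(** * Sums over representations *)

Lemma F_ge0 k (x : (2 * k).-tuple int) : 0 <= F x.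
Proof. by apply: sumr_ge0 => j _; nia. Qed.

Lemma summable_F k (c : (2 * k).-tuple int -> int) : summable (@F k) c.
Proof.
split=> [x _|n]; first exact: F_ge0.
have /finite_seqP[r rE] : finite_set (\bigcup_(m in `I_n.+1) @reps k m).
  by apply: bigcup_finite => [|m _]; [exact: finite_II|exact: finite_reps].
exists r => x _ le_n; suff : [set` r] x by [].
rewrite -rE; exists `|F x|%N; have := F_ge0 x => /=; first by lia.
by rewrite /reps /=; lia.
Qed.

(** The form [F] is a sum over pairs, so the first pair of coordinates splits off as a factor. *)
Lemma qsum_tuple k (f : int -> int) :
  qsum (@F k.+1) (fun x => f x`_0) = lat (fun m _ => f m) * qsum (@F k) (fun=> 1).
Proof.
pose h (p : (int * int) * (2 * k).-tuple int) : (2 * k.+1).-tuple int :=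
  tcast (esym (mulnS 2 k)) [tuple of p.1.1 :: p.1.2 :: p.2].
have hE p : h p = p.1.1 :: p.1.2 :: p.2 :> seq int by rewrite val_tcast.
rewrite (qsum_reindex (h := h)); first last.
- move=> x _; have sx : size (behead (behead x)) == (2 * k)%N.
    by rewrite !size_behead size_tuple mulnS.
  exists ((x`_0, x`_1), Tuple sx); apply: val_inj; rewrite /= hE /=.
  by case: x sx => -[|a [|b s]] //=; rewrite mulnS.
- move=> [[a b] t] [[a' b'] t'] /(congr1 val); rewrite /= !hE => -[-> -> tt'].
  by congr (_, _); apply: val_inj.
rewrite (qsumM (summable_nform _) (summable_F _)).
apply: eq_qsum => [p|p _] /=; first by rewrite hE mulr1.
rewrite /F big_ord_recl hE; congr (_ + _).
by apply: eq_bigr => i _; rewrite lift0 mulnS !addSn add0n.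
Qed.

Lemma qsum_F1 k : qsum (@F k) (fun=> 1) = a2 ^+ k.
Proof.
elim: k => [|k IH]; last by rewrite (qsum_tuple k (fun=> 1)) IH exprS.
apply: fpsP => n; rewrite expr0 coeff1 (qsum_seq (r := [:: [tuple]])) //; last first.
  by move=> t; rewrite inE tuple0.
by rewrite big_seq1 /F big_ord0; case: n.
Qed.

Lemma coeff_iterD i (x : fps) n : iter i D x n = n%:Z ^+ i * x n.
Proof. by elim: i => [|i IH]; rewrite ?mul1r // iterS coeff_D IH exprS mulrA. Qed.

(** A triple lists a coefficient, the exponent of [n] and the exponent of [x_1]; powers of [n]
    become iterates of [D]. *)
Lemma sum_reps k n (s : seq (int * nat * nat)) :
  \sum_(x \in @reps k.+1 n) \sum_(t <- s) t.1.1 * n%:Z ^+ t.1.2 * x`_0 ^+ t.2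
  = (\sum_(t <- s) t.1.1%:~R * iter t.1.2 D (moment t.2 * a2 ^+ k)) n.
Proof.
have coeff_sum (r : seq (int * nat * nat)) (x : int * nat * nat -> fps) :
    (\sum_(t <- r) x t) n = \sum_(t <- r) x t n.
  by elim: r => [|t r IH]; rewrite ?big_nil // !big_cons coeffD IH.
transitivity (\sum_(t <- s) qsum (@F k.+1) (fun x => t.1.1 * n%:Z ^+ t.1.2 * x`_0 ^+ t.2) n).
  rewrite -coeff_sum -qsum_sum ?qsumE // => t; exact: summable_F.
rewrite coeff_sum; apply: eq_bigr => t _.
rewrite qsumZ coeffMz coeffMz coeff_iterD mulrA; congr (_ * _).
by rewrite (qsum_tuple k (fun m => m ^+ t.2)) qsum_F1.
Qed.

(** [conv] runs over positive indices only; the two end terms of the Cauchy product vanish because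
    both constant terms are 0. *)
Lemma conv_coeff r (L : nat -> int) n : (0 < n)%N -> L 0%N = 0 ->
  conv (sigma r) L n = (sigma_gf r * Fps L) n.
Proof.
move=> n_gt0 L0; rewrite convE coeffM -(big_mkord xpredT (fun i => sigma_gf r i * L (n - i)%N)).
rewrite big_ltn // sigma_gf_0 mul0r add0r big_nat_recr // subnn L0 mulr0.
by apply: etrans (esym (addr0 _)); rewrite !big_nat; apply: eq_bigr => i /andP[i_gt0 _]; rewrite coeff_sigma_gf.
Qed.

Lemma gf_of_sum k (s : seq (int * nat * nat)) (L : nat -> int) :
  (forall n, L n = \sum_(x \in @reps k.+1 n)
     \sum_(t <- s) t.1.1 * n%:Z ^+ t.1.2 * x`_0 ^+ t.2) ->
  Fps L = \sum_(t <- s) t.1.1%:~R * iter t.1.2 D (moment t.2 * a2 ^+ k).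
Proof. by move=> LE; apply: fpsP => n; rewrite -sum_reps -LE. Qed.

Ltac gf_of_sum k s := rewrite (@gf_of_sum k s); [rewrite !big_cons big_nil; cbn [fst snd iter]; ring
  |move=> ?; apply: eq_fsbigr => ? _; rewrite !big_cons big_nil; cbn [fst snd]; ring].

Lemma L6_2E : Fps L6_2 = 9%:R * (moment 4 * a2 ^+ 1) - 9%:R * D (moment 2 * a2 ^+ 1)
  + D (D (moment 0 * a2 ^+ 1)).
Proof. gf_of_sum 1%N [:: (9 : int, 0%N, 4%N); (- 9 : int, 1%N, 2%N); (1 : int, 2%N, 0%N)]. Qed.

Lemma L8_4E : Fps L8_4 = 45%:R * (moment 4 * a2 ^+ 3) - 30%:R * D (moment 2 * a2 ^+ 3)
  + 2%:R * D (D (moment 0 * a2 ^+ 3)).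
Proof. gf_of_sum 3%N [:: (45 : int, 0%N, 4%N); (- 30 : int, 1%N, 2%N); (2 : int, 2%N, 0%N)]. Qed.

Lemma L10_6E : Fps L10_6 = 42%:R * (moment 4 * a2 ^+ 5) - 21%:R * D (moment 2 * a2 ^+ 5)
  + D (D (moment 0 * a2 ^+ 5)).
Proof. gf_of_sum 5%N [:: (42 : int, 0%N, 4%N); (- 21 : int, 1%N, 2%N); (1 : int, 2%N, 0%N)]. Qed.

Lemma L14_10E : Fps L14_10 = 99%:R * (moment 4 * a2 ^+ 9) - 33%:R * D (moment 2 * a2 ^+ 9)
  + D (D (moment 0 * a2 ^+ 9)).
Proof. gf_of_sum 9%N [:: (99 : int, 0%N, 4%N); (- 33 : int, 1%N, 2%N); (1 : int, 2%N, 0%N)]. Qed.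

Lemma L14_8E : Fps L14_8 = 594%:R * (moment 6 * a2 ^+ 7) - 495%:R * D (moment 4 * a2 ^+ 7)
  + 90%:R * D (D (moment 2 * a2 ^+ 7)) - 2%:R * D (D (D (moment 0 * a2 ^+ 7))).
Proof.
gf_of_sum 7%N [:: (594 : int, 0%N, 6%N); (- 495 : int, 1%N, 4%N); (90 : int, 2%N, 2%N);
  (- 2 : int, 3%N, 0%N)].
Qed.

Lemma L14_6E : Fps L14_6 = 8019%:R * (moment 8 * a2 ^+ 5) - 12474%:R * D (moment 6 * a2 ^+ 5)
  + 5670%:R * D (D (moment 4 * a2 ^+ 5)) - 756%:R * D (D (D (moment 2 * a2 ^+ 5)))
  + 14%:R * D (D (D (D (moment 0 * a2 ^+ 5)))).
Proof.
gf_of_sum 5%N [:: (8019%:R : int, 0%N, 8%N); (- 12474%:R : int, 1%N, 6%N); (5670%:R : int, 2%N, 4%N);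
  (- 756 : int, 3%N, 2%N); (14 : int, 4%N, 0%N)].
Qed.

(** * The convolution identity *)

Lemma cusp6_0 : cusp6 0 = 0.
Proof. by rewrite /cusp6 /Y -lock !fpsE0 coeff_D a2_0 E2_0. Qed.

Lemma scaled_0 k (x y : fps) : k.+1%:R * x = cusp6 * y -> x 0 = 0.
Proof.
move=> /(congr1 (fun z : fps => z 0)); rewrite coeffMnat coeffM0 cusp6_0 mul0r => /eqP.
by rewrite mulf_eq0 pnatr_eq0 => /eqP.
Qed.

Lemma coeff_lin3 n (k1 k2 k3 l1 l2 l3 : nat) (x1 x2 x3 y1 y2 y3 : fps) :
  k1%:R * x1 + k2%:R * x2 + k3%:R * x3 = l1%:R * y1 + l2%:R * y2 + l3%:R * y3 ->
  k1%:R * x1 n + k2%:R * x2 n + k3%:R * x3 n = l1%:R * y1 n + l2%:R * y2 n + l3%:R * y3 n.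
Proof. by move=> /(congr1 (fun z : fps => z n)); rewrite !(coeffD, coeffMnat). Qed.

(** The theorem times its least common denominator [33075 = 3^3 5^2 7^2]. Each convolution joins its
    own [L] as a coefficient of [E8 L], [E6 L] or [E4 L], as in [73760 = 480 * 461/3]. *)
Lemma corollary2p5_int (n : nat) : (0 < n)%N ->
  5082525%:R * (L6_2 n + 480%:R * conv (sigma 7) L6_2 n)
  + 4253200%:R * (L8_4 n - 504%:R * conv (sigma 5) L8_4 n)
  + 8315055%:R * (L10_6 n + 240%:R * conv (sigma 3) L10_6 n)
  = 4251465%:R * L14_10 n + 116640%:R * L14_8 n + 27216%:R * L14_6 n :> int.
Proof.
move=> n_gt0.
have h6 := gf6_2; rewrite -L6_2E in h6; have h8 := gf8_4; rewrite -L8_4E in h8.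
have h10 := gf10_6; rewrite -L10_6E in h10.
have h14 := gf14_10; rewrite -L14_10E in h14; have h14' := gf14_8; rewrite -L14_8E in h14'.
have h14'' := gf14_6; rewrite -L14_6E in h14''.
have L6_0 : L6_2 0 = 0 by apply: (@scaled_0 35 (Fps L6_2) 1); rewrite mulr1.
have L8_0 : L8_4 0 = 0 by apply: (@scaled_0 3 (Fps L8_4) (a2 ^+ 2)).
have L10_0 : L10_6 0 = 0.
  by apply: (@scaled_0 17 (Fps L10_6) (5%:R * a2 ^+ 4)); rewrite h10; ring.
have := coeff_lin3 n (cusp_identity h6 h8 h10 h14 h14' h14'').
have -> : (E8 * Fps L6_2) n = L6_2 n + 480%:R * conv (sigma 7) L6_2 n.
  by rewrite E8E mulrDl mul1r -mulrA coeffD coeffMnat conv_coeff.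
have -> : (E6 * Fps L8_4) n = L8_4 n - 504%:R * conv (sigma 5) L8_4 n.
  by rewrite E6E mulrBl mul1r -mulrA coeffB coeffMnat conv_coeff.
have -> : (E4 * Fps L10_6) n = L10_6 n + 240%:R * conv (sigma 3) L10_6 n.
  by rewrite E4E mulrDl mul1r -mulrA coeffD coeffMnat conv_coeff.
exact.
Qed.

(** The coefficients are variables so that the cast to the rationals never computes with large
    numerals. *)
Lemma intr_lin (k1 k2 k3 l1 l2 l3 c1 c2 c3 : nat) (x1 x2 x3 z1 z2 z3 y1 y2 y3 : int) :
  k1%:R * (x1 + c1%:R * z1) + k2%:R * (x2 - c2%:R * z2) + k3%:R * (x3 + c3%:R * z3)
  = l1%:R * y1 + l2%:R * y2 + l3%:R * y3 ->
  k1%:R * (x1%:~R + c1%:R * z1%:~R) + k2%:R * (x2%:~R - c2%:R * z2%:~R)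
  + k3%:R * (x3%:~R + c3%:R * z3%:~R)
  = l1%:R * y1%:~R + l2%:R * y2%:~R + l3%:R * y3%:~R :> rat.
Proof.
by move=> /(congr1 (fun z : int => z%:~R : rat)); rewrite !(rmorphD, rmorphN, rmorphM, rmorph_nat).
Qed.

Theorem corollary2p5 (n : nat) (n_ge1 : (1 <= n)%N) :
  73760%:R * (conv (sigma 7) L6_2 n)%:~R
  - 194432%:R / 3 * (conv (sigma 5) L8_4 n)%:~R
  + 60336%:R * (conv (sigma 3) L10_6 n)%:~R
  = - (461 / 3) * (L6_2 n)%:~R
    - 3472 / 27 * (L8_4 n)%:~R
    - 1257 / 5 * (L10_6 n)%:~R
    + 94477%:R / 735 * (L14_10 n)%:~R
    + 864 / 245 * (L14_8 n)%:~R
    + 144 / 175 * (L14_6 n)%:~R :> rat.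
Proof.
have := intr_lin (corollary2p5_int n_ge1).
move: (conv _ _ n) (conv _ _ n) (conv _ _ n) (L6_2 n) (L8_4 n) (L10_6 n) (L14_10 n) (L14_8 n)
  (L14_6 n) => z1 z2 z3 x1 x2 x3 y1 y2 y3 E.
lra.
Qed.
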